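(* Define integers $C_{1^{4}2^{4}3^{-2}}(n)$ by \[ \frac{(q;q)_\infty^{4}\,(q^2;q^2)_\infty^{4}}{(q^3;q^3)_\infty^{2}}=\sum_{n\geq 0} C_{1^{4}2^{4}3^{-2}}(n)\,q^n . \] Then the sequence $\{\operatorname{sgn}(C_{1^{4}2^{4}3^{-2}}(n))\}_{n\geq 1}$ is periodic with period $3$; in particular, for every $n\ge 1$, \[ \operatorname{sgn}\left(C_{1^{4}2^{4}3^{-2}}(n)\right)=\begin{cases}1 & \text{if } 3\mid n,\\ -1 & \text{otherwise.}\end{cases} \]
   Context: $(a;q)_\infty:=\prod_{j\geq 0}(1-aq^j)$ denotes the $q$-Pochhammer symbol; the identity is one of formal power series in $q$. *)

(* Defs.v *)
From mathcomp Require Import all_boot all_order all_algebra.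
Set Implicit Arguments. Unset Strict Implicit. Unset Printing Implicit Defensive.
Import Order.TTheory GRing.Theory Num.Theory.
Local Open Scope ring_scope.

Definition series := nat -> int.

Definition smul (a b : series) : series :=
  fun n => \sum_(i < n.+1) a i * b (n - i)%N.

Definition sone : series := fun n => (n == 0%N)%:Z.

Definition sexp (a : series) (k : nat) : series := iter k (smul a) sone.

Definition one_minus_q (m : nat) : series :=
  fun n => (n == 0%N)%:Z - (n == m)%:Z.

(* the series 1/(1 - q^m) = sum_i q^(m i)  (m >= 1) *)
Definition inv_one_minus_q (m : nat) : series :=
  fun n => (m %| n)%N%:Z.

Definition poch_trunc (m N : nat) : series :=
  \big[smul/sone]_(j < N) one_minus_q (m * j.+1).

Definition inv_poch_trunc (m N : nat) : series :=
  \big[smul/sone]_(j < N) inv_one_minus_q (m * j.+1).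

(* N-th partial product of (q;q)^4 (q^2;q^2)^4 / (q^3;q^3)^2 ;
   its coefficient of q^n equals C_{1^4 2^4 3^-2}(n) as soon as N > n,
   since the omitted factors are 1 + O(q^{N+1}). *)
Definition F_trunc (N : nat) : series :=
  smul (smul (sexp (poch_trunc 1 N) 4) (sexp (poch_trunc 2 N) 4))
       (sexp (inv_poch_trunc 3 N) 2).

(* Main.v *)
(* Write f_k = (q^k;q^k)_oo, psi = f_2^2/f_1, Psi = psi(q^3), P = f_2 f_3^2/(f_1 f_6),
   and let a, b = f_1^3/f_3 and c = f_3^3/f_1 be the cubic theta functions
   (c normalised to constant term 1).  Then f_1^4 f_2^4/f_3^2 = (b psi)^2, and both
   factors have simple 3-dissections: psi = P(q^3) + q Psi(q^3) and
   b = a(q^3) - 3 q c(q^3).  With 3 c P - a Psi = 2 Psi a(q^2) and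
   b b(q^2) = a a(q^2) - 9 q c c(q^2), squaring b psi gives the three sections
     n = 0 mod 3:    a^2 P^2 + 12 q c Psi^2 a(q^2),
     n = 1 mod 3:  - P Psi (3 a a(q^2) + b b(q^2)),
     n = 2 mod 3:  - 2 Psi^2 (a a(q^2) + 18 q c c(q^2)).
   The series c has nonnegative coefficients because
   c = psi(q^2) P(q^2) + q c(q^4); then so has a = a(q^3) + 6 q c(q^3), and the
   coefficients of b are bounded by those of a.  The same recursions show that a
   has a positive coefficient at every value of x^2 + xy + y^2, so every coefficient of a a(q^2)
   is positive: by Lagrange's four square theorem x^2 + 3y^2 + 2(z^2 + 3w^2)
   represents every natural number. *)
Require Import Defs.
From mathcomp Require Import all_boot all_order all_algebra.
From HB Require Import structures.
From mathcomp Require Import boolp.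
From mathcomp Require Import zify ring.
Import Order.TTheory GRing.Theory Num.Theory.
Local Open Scope ring_scope.
Set Implicit Arguments.
Unset Strict Implicit.
Unset Printing Implicit Defensive.

(** * Formal power series over the integers *)

(** Two devices do the work of modular forms here. Power series over the integers form an integral
    domain, so an identity between eta quotients is checked after multiplication by Euler products,
    which are then cancelled. The quartic relation psi^4 = Psi (P^3 + q Psi^3) and an eta quotient
    for P^3 - 8 q Psi^3 come from a norm over the cube roots of q. Written as a polynomial in the
    three sections, this norm is multiplicative and explicit on Euler products, so it evaluates
    P(q^3) + q Psi(q^3) and P(q^3) - 2 q Psi(q^3) in closed form. The series a is not introduced by
    its double sum but as psi^3/Psi + 3 q Psi^3/psi. Its dissections and its relations to c and
    a(q^2) then become polynomial identities in psi, Psi and P; the price is that positivity is no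
    longer visible and has to be recovered from the recursions. The even half of c is identified
    through its square, by a norm over the square roots of q, and its constant term settles the
    sign. *)

Record fps := Fps { coef : nat -> int }.

HB.instance Definition _ := gen_eqMixin fps.
HB.instance Definition _ := gen_choiceMixin fps.

Lemma fpsP (F G : fps) : coef F =1 coef G -> F = G.
Proof. by case: F G => [f] [g] /= /funext ->. Qed.

Definition fps_add F G := Fps (fun n => coef F n + coef G n).
Definition fps_opp F := Fps (fun n => - coef F n).
Definition fps_mul F G := Fps (smul (coef F) (coef G)).
Definition fps_const (c : int) := Fps (fun n => if n == 0%N then c else 0).

Fact fps_addA : associative fps_add.
Proof. by move=> F G H; apply: fpsP => n /=; rewrite addrA. Qed.
Fact fps_addC : commutative fps_add.
Proof. by move=> F G; apply: fpsP => n /=; rewrite addrC. Qed.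
Fact fps_add0 : left_id (fps_const 0) fps_add.
Proof. by move=> F; apply: fpsP => n /=; rewrite if_same add0r. Qed.
Fact fps_addN : left_inverse (fps_const 0) fps_opp fps_add.
Proof. by move=> F; apply: fpsP => n /=; rewrite if_same addNr. Qed.

HB.instance Definition _ :=
  GRing.isZmodule.Build fps fps_addA fps_addC fps_add0 fps_addN.

Definition truncp (N : nat) (F : fps) : {poly int} := \poly_(i < N) coef F i.

(** Low coefficients of a product only see truncations of the factors, so the ring laws are
    inherited from [{poly int}]. *)
Lemma coef_mul_truncp N F G n : (n < N)%N ->
  coef (fps_mul F G) n = (truncp N F * truncp N G)`_n.
Proof.
move=> nN; rewrite coefM; apply: eq_bigr => i _; rewrite !coef_poly.
have -> : (i < N)%N by have := ltn_ord i; lia.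
by have -> : (n - i < N)%N by lia.
Qed.

Fact fps_mulC : commutative fps_mul.
Proof.
by move=> F G; apply: fpsP => n; rewrite !(@coef_mul_truncp n.+1)// mulrC.
Qed.
Fact fps_mulA : associative fps_mul.
Proof.
move=> F G H; apply: fpsP => n; pose N := n.+1.
have tM A B i : (i < N)%N -> (truncp N (fps_mul A B))`_i =
    (truncp N A * truncp N B)`_i.
  by move=> iN; rewrite coef_poly iN (@coef_mul_truncp N).
have -> : coef (fps_mul F (fps_mul G H)) n =
    (truncp N F * (truncp N G * truncp N H))`_n.
  rewrite (@coef_mul_truncp N)// !(coefM (truncp N F)).
  by apply: eq_bigr => i _; rewrite tM// /N; lia.
have -> : coef (fps_mul (fps_mul F G) H) n =
    (truncp N F * truncp N G * truncp N H)`_n.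
  rewrite (@coef_mul_truncp N)// !(coefMr _ (truncp N H)).
  by apply: eq_bigr => i _; rewrite tM// /N; lia.
by rewrite mulrA.
Qed.
Fact fps_mul1 : left_id (fps_const 1) fps_mul.
Proof.
move=> F; apply: fpsP => n; rewrite /= /smul big_ord_recl /= mul1r subn0.
by rewrite big1 ?addr0// => i _; rewrite mul0r.
Qed.
Fact fps_mulDl : left_distributive fps_mul fps_add.
Proof.
move=> F G H; apply: fpsP => n; rewrite /= /smul -big_split /=.
by apply: eq_bigr => i _; rewrite mulrDl.
Qed.
Fact fps_oner_neq0 : fps_const 1 != fps_const 0.
Proof. by apply/eqP => /(congr1 (fun F => coef F 0)). Qed.

HB.instance Definition _ := GRing.Zmodule_isComNzRing.Build fps
  fps_mulA fps_mulC fps_mul1 fps_mulDl fps_oner_neq0.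

Lemma coef0 n : coef 0 n = 0. Proof. by rewrite /= if_same. Qed.
Lemma coef1 n : coef 1 n = (n == 0%N)%:Z. Proof. by case: n. Qed.
Lemma coefD F G n : coef (F + G) n = coef F n + coef G n. Proof. by []. Qed.
Lemma coefN F n : coef (- F) n = - coef F n. Proof. by []. Qed.
Lemma coefB F G n : coef (F - G) n = coef F n - coef G n. Proof. by []. Qed.
Lemma coefM F G n :
  coef (F * G) n = \sum_(i < n.+1) coef F i * coef G (n - i)%N.
Proof. by []. Qed.
Lemma coefM0 F G : coef (F * G) 0 = coef F 0 * coef G 0.
Proof. by rewrite coefM big_ord1. Qed.
Lemma coefMn F m n : coef (F *+ m) n = coef F n *+ m.
Proof. by elim: m => [|m IH]; rewrite ?mulr0n ?coef0// !mulrS coefD IH. Qed.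
Lemma coef_nat m n : coef m%:R n = if n == 0%N then m%:R else 0.
Proof. by rewrite coefMn coef1; case: n => //=; rewrite mul0rn. Qed.
Lemma coef_natM m F n : coef (m%:R * F) n = m%:R * coef F n.
Proof. by rewrite mulr_natl coefMn mulr_natl. Qed.
Lemma coef_sum (I : Type) (r : seq I) (P : pred I) (F : I -> fps) n :
  coef (\sum_(i <- r | P i) F i) n = \sum_(i <- r | P i) coef (F i) n.
Proof.
by elim/big_rec2: _ => [|i x y _ <-]; rewrite ?coef0// coefD.
Qed.

Definition q : fps := Fps (fun n => (n == 1%N)%:Z).

Lemma coefqM F n : coef (q * F) n = if n is m.+1 then coef F m else 0.
Proof.
case: n => [|n]; first by rewrite coefM0 mul0r.
rewrite coefM big_ord_recl mul0r add0r big_ord_recl /= mul1r subn1.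
by rewrite big1 ?addr0// => i _; rewrite mul0r.
Qed.

Lemma coefqnM k F n :
  coef (q ^+ k * F) n = if (n < k)%N then 0 else coef F (n - k)%N.
Proof.
elim: k n => [|k IH] n; first by rewrite mul1r subn0.
by rewrite exprS -mulrA coefqM; case: n => [|n]//; rewrite IH ltnS subSS.
Qed.

Lemma coefqn k n : coef (q ^+ k) n = (n == k)%:Z.
Proof.
rewrite -(mulr1 (q ^+ k)) coefqnM coef1; case: ltnP => h.
  by case: eqP => // E; lia.
by congr (Posz (nat_of_bool _)); lia.
Qed.

(** With m the order of F, strong induction on n reduces the coefficient of q^(m+n) in F G to F_m
    G_n. All later cancellations of Euler products and theta series rest on this. *)
Fact fps_integral (F G : fps) : F * G = 0 -> (F == 0) || (G == 0).
Proof.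
move=> FG0; case: (eqVneq F 0) => //= F0; apply/eqP/fpsP => n.
have [i Fi] : exists i, coef F i != 0.
  apply: contrapT => h; case/eqP: F0; apply: fpsP => i; rewrite coef0.
  by apply/eqP; apply: contrapT => Fi; apply: h; exists i; apply/negP.
have /ex_minnP [m Fm min_m] : exists i, coef F i != 0 by exists i.
rewrite coef0; elim/ltn_ind: n => n IH.
have := congr1 (fun H => coef H (m + n)) FG0; rewrite coef0 coefM.
have mlt : (m < (m + n).+1)%N by lia.
rewrite (bigD1 (Ordinal mlt)) //= addKn big1 ?addr0.
  by move/eqP; rewrite mulf_eq0 (negbTE Fm) => /eqP.
move=> j; rewrite -val_eqE /= => jm.
case: (ltnP j m) => hj; last first.
  by rewrite IH ?mulr0//; have := ltn_ord j; lia.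
case: (eqVneq (coef F j) 0) => [->|/min_m]; first by rewrite mul0r.
by lia.
Qed.

Definition fps_unit : {pred fps} := fun F => `[< exists G, G * F = 1 >].
Definition fps_inv (F : fps) : fps :=
  if pselect (exists G, G * F = 1) is left ex then projT1 (cid ex) else F.

Fact fps_mulVr : {in fps_unit, left_inverse 1 fps_inv *%R}.
Proof.
move=> F /asboolP ex; rewrite /fps_inv.
by case: pselect => // ex'; case: cid.
Qed.
Fact fps_unitPl F G : G * F = 1 -> fps_unit F.
Proof. by move=> GF; apply/asboolP; exists G. Qed.
Fact fps_inv_out : {in [predC fps_unit], fps_inv =1 id}.
Proof.
move=> F /asboolP ex; rewrite /fps_inv.
by case: pselect => // ex'; case: ex.
Qed.

HB.instance Definition _ := GRing.ComNzRing_hasMulInverse.Build fps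
  fps_mulVr fps_unitPl fps_inv_out.
HB.instance Definition _ := GRing.ComUnitRing_isIntegral.Build fps fps_integral.

(** * Congruence modulo q^M *)

Definition eqmod (M : nat) (F G : fps) :=
  forall i, (i < M)%N -> coef F i = coef G i.

Lemma eqmod_refl M F : eqmod M F F. Proof. by []. Qed.
Lemma eqmod_sym M F G : eqmod M F G -> eqmod M G F.
Proof. by move=> h i /h ->. Qed.
Lemma eqmod_trans M F G H : eqmod M F G -> eqmod M G H -> eqmod M F H.
Proof. by move=> h1 h2 i iM; rewrite h1 ?h2. Qed.
Lemma eqmodD M F F' G G' :
  eqmod M F F' -> eqmod M G G' -> eqmod M (F + G) (F' + G').
Proof. by move=> h1 h2 i iM; rewrite !coefD h1 ?h2. Qed.
Lemma eqmodB M F F' G G' :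
  eqmod M F F' -> eqmod M G G' -> eqmod M (F - G) (F' - G').
Proof. by move=> h1 h2 i iM; rewrite !coefB h1 ?h2. Qed.
Lemma eqmodM M F F' G G' :
  eqmod M F F' -> eqmod M G G' -> eqmod M (F * G) (F' * G').
Proof.
move=> h1 h2 i iM; rewrite !coefM; apply: eq_bigr => j _.
by rewrite h1 ?h2//; have := ltn_ord j; lia.
Qed.
Lemma eqmodX M F F' k : eqmod M F F' -> eqmod M (F ^+ k) (F' ^+ k).
Proof.
by move=> h; elim: k => [|k IH]; rewrite ?expr0// !exprS; apply: eqmodM.
Qed.
Lemma eqmod_le M N F G : (N <= M)%N -> eqmod M F G -> eqmod N F G.
Proof. by move=> NM h i iN; apply: h; lia. Qed.
Lemma eqmod_eq F G : (forall M, eqmod M F G) -> F = G.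
Proof. by move=> h; apply: fpsP => n; apply: (h n.+1). Qed.
Lemma eqmodqn0 M k F : (M <= k)%N -> eqmod M (q ^+ k * F) 0.
Proof. by move=> Mk i iM; rewrite coefqnM coef0 ifT//; lia. Qed.
Lemma eqmod_prod M (I : Type) (r : seq I) (P : pred I) (F G : I -> fps) :
  (forall i, P i -> eqmod M (F i) (G i)) ->
  eqmod M (\prod_(i <- r | P i) F i) (\prod_(i <- r | P i) G i).
Proof.
by move=> h; elim/big_rec2: _ => [|i x y Pi IH]//; apply: eqmodM => //; apply: h.
Qed.
Lemma eqmod_sum M (I : Type) (r : seq I) (P : pred I) (F G : I -> fps) :
  (forall i, P i -> eqmod M (F i) (G i)) ->
  eqmod M (\sum_(i <- r | P i) F i) (\sum_(i <- r | P i) G i).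
Proof.
by move=> h; elim/big_rec2: _ => [|i x y Pi IH]//; apply: eqmodD => //; apply: h.
Qed.

(** Geometric series in H = 1 - F = q K. Since H^k = O(q^k), the coefficient of q^n of the inverse
    can be read off the partial sum up to H^n. *)
Lemma fps_unitP F : coef F 0 = 1 -> F \is a GRing.unit.
Proof.
move=> F0; pose H := 1 - F.
have H0 : coef H 0 = 0 by rewrite coefB F0.
have HX : exists K, H = q * K.
  exists (Fps (fun n => coef H n.+1)); apply: fpsP => -[|n]; rewrite coefqM//.
have [K HK] := HX.
pose S n := \sum_(k < n.+1) H ^+ k.
pose G := Fps (fun n => coef (S n) n).
have GS M : eqmod M.+1 G (S M).
  move=> i iM; rewrite /= /S -!(big_mkord predT (fun k => H ^+ k)).
  rewrite [in RHS](@big_cat_nat _ _ _ i.+1)// coefD.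
  rewrite [Y in _ + Y](_ : _ = 0) ?addr0// coef_sum big_nat big1// => k ki.
  by rewrite HK exprMn (@eqmodqn0 k) ?coef0//; lia.
suff : G * F = 1 by move=> GF; apply: (fps_unitPl GF).
apply: eqmod_eq => M; apply: (@eqmod_le M.+1) => //.
apply: (@eqmod_trans _ _ (S M * F)); first exact: eqmodM.
have -> : S M * F = 1 - q ^+ M.+1 * K ^+ M.+1.
  rewrite -exprMn -HK mulrC -[F](subKr 1) -/H /S.
  by rewrite -[1 - H]opprB mulNr -subrX1 opprB.
rewrite -[Y in eqmod _ _ Y]subr0; apply: eqmodB => //.
exact: eqmodqn0.
Qed.

(** * Dilations and sections *)

(** The series F(q^k). As 0 divides only 0, [dil 0 F] is the constant term of F, so that [dil k] is
    a ring morphism for every k. *)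
Definition dil (k : nat) (F : fps) : fps :=
  Fps (fun n => if (k %| n)%N then coef F (n %/ k) else 0).

Lemma coef_dil k F n :
  coef (dil k F) n = if (k %| n)%N then coef F (n %/ k) else 0.
Proof. by []. Qed.

Fact dil_is_additive k : zmod_morphism (dil k).
Proof.
move=> F G; apply: fpsP => n; rewrite coefB !coef_dil; case: ifP => _.
  by rewrite coefB.
by rewrite subr0.
Qed.

Fact dil_is_multiplicative k : GRing.monoid_morphism (dil k).
Proof.
split.
  apply: fpsP => n; rewrite coef_dil !coef1.
  case: ifP => [/dvdnP [m ->]|h]; last by case: n h => //; rewrite dvdn0.
  case: k => [|k]; first by rewrite muln0 div0n.
  by rewrite mulnK//; case: m.
move=> F G; apply: fpsP => n; case: k => [|k].
  case: n => [|n]; first by rewrite coef_dil !coefM0 !coef_dil.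
  rewrite coefM coef_dil big1// => i _; rewrite !coef_dil.
  rewrite !dvd0n; case: (eqVneq (i : nat) 0%N) => [->|]; last by rewrite mul0r.
  by rewrite subn0 mulr0.
(* For a positive exponent the substitution is polynomial composition with a power of X, whose
   multiplicativity is known. *)
have tE N A i : (i < N)%N -> coef (dil k.+1 A) i = (truncp N A \Po 'X^(k.+1))`_i.
  move=> iN; rewrite coef_comp_poly_Xn//= coef_poly.
  by rewrite (leq_ltn_trans (leq_div _ _) iN).
rewrite (tE n.+1)//.
have -> : coef (dil k.+1 F * dil k.+1 G) n =
    ((truncp n.+1 F * truncp n.+1 G) \Po 'X^(k.+1))`_n.
  rewrite comp_polyM coefM poly.coefM; apply: eq_bigr => i _.
  by rewrite -!tE//; lia.
rewrite !coef_comp_poly_Xn//; case: ifP => // _.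
have h : (n %/ k.+1 < n.+1)%N by rewrite ltnS leq_div.
by rewrite -(coef_mul_truncp _ _ h) coef_poly h.
Qed.

HB.instance Definition _ k :=
  GRing.isZmodMorphism.Build fps fps (dil k) (dil_is_additive k).
HB.instance Definition _ k :=
  GRing.isMonoidMorphism.Build fps fps (dil k)
    (dil_is_multiplicative k).

Lemma dilq k : (0 < k)%N -> dil k q = q ^+ k.
Proof.
move=> k0; apply: fpsP => n; rewrite coefqn coef_dil /=.
case: ifP => [/dvdnP [m ->]|h].
  by rewrite mulnK//; congr (Posz (nat_of_bool _)); apply/eqP/eqP; nia.
by case: eqP => // E; rewrite E dvdnn in h.
Qed.

Lemma dil_dil j k F : (0 < j)%N -> (0 < k)%N -> dil j (dil k F) = dil (j * k) F.
Proof.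
move=> j0 k0; apply: fpsP => n; rewrite !coef_dil.
case: (boolP (j * k %| n)%N) => [/dvdnP [m ->]|h].
  rewrite dvdn_mull ?dvdn_mulr// [(m * _)%N](_ : _ = m * k * j)%N; last by lia.
  by rewrite mulnK// dvdn_mull// mulnK// mulnAC -mulnA mulnC mulKn ?muln_gt0 ?j0.
case: ifP => // /dvdnP [m E]; rewrite E mulnK//; case: ifP => // /dvdnP [l E'].
by case/negP: h; rewrite E E'; apply/dvdnP; exists l; lia.
Qed.

Lemma dil_inj k : (0 < k)%N -> injective (dil k).
Proof.
move=> k0 F G E; apply: fpsP => n.
have := congr1 (fun H => coef H (n * k)) E.
by rewrite !coef_dil dvdn_mull// mulnK.
Qed.

Definition sec (m j : nat) (F : fps) : fps := Fps (fun n => coef F (m * n + j)).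

Lemma coef_sec m j F n : coef (sec m j F) n = coef F (m * n + j).
Proof. by []. Qed.

Lemma secD m j F G : sec m j (F + G) = sec m j F + sec m j G.
Proof. by apply: fpsP. Qed.

Lemma sec_dil m j F : (0 < m)%N -> (j < m)%N ->
  sec m j (dil m F) = if j == 0%N then F else 0.
Proof.
move=> m0 jm; apply: fpsP => n; rewrite coef_sec coef_dil.
rewrite dvdn_addr ?dvdn_mulr//; case: (posnP j) => [->|j0].
  by rewrite dvdn0 addn0 mulKn.
by rewrite gtnNdvd// coef0.
Qed.

Lemma sec_qnM m j k F : (k <= j)%N -> sec m j (q ^+ k * F) = sec m (j - k) F.
Proof.
move=> kj; apply: fpsP => n; rewrite !coef_sec coefqnM ifF ?addnBA//.
by apply: ltn_geF; lia.
Qed.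

(** The residue j - k is negative here; passing to m + j - k lowers the quotient by one, which costs
    a factor q. *)
Lemma sec_qnM_wrap m j k F : (0 < m)%N -> (j < k)%N -> (k <= m)%N ->
  sec m j (q ^+ k * F) = q * sec m (m + j - k) F.
Proof.
move=> m0 jk km; apply: fpsP => n; rewrite coefqM coef_sec coefqnM ?coef_sec.
case: n => [|n]; first by rewrite muln0 jk.
rewrite ifF; first by congr coef; lia.
by apply: ltn_geF; nia.
Qed.

Lemma dissect3 F :
  F = dil 3 (sec 3 0 F) + q * dil 3 (sec 3 1 F) + q ^+ 2 * dil 3 (sec 3 2 F).
Proof.
apply: fpsP => n; rewrite !coefD -[q * _]/(q ^+ 1 * _) !coefqnM !coef_dil.
rewrite !coef_sec.
have [m [j [-> j3]]] : exists m j, n = (3 * m + j)%N /\ (j < 3)%N.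
  by exists (n %/ 3)%N, (n %% 3)%N; rewrite ltn_mod {1}(divn_eq n 3) mulnC.
have nd i : (0 < i < 3)%N -> (3 %| 3 * m + i)%N = false.
  by move=> i3; apply/negbTE/negP => /dvdnP [l]; lia.
case: j j3 => [|[|[|]]]// _.
- rewrite addn0 dvdn_mulr// mulKn// addn0.
  case: m {nd} => [|m]; first by rewrite !addr0.
  have -> : (3 * m.+1 - 1 = 3 * m + 2)%N by lia.
  have -> : (3 * m.+1 - 2 = 3 * m + 1)%N by lia.
  have nd i : (0 < i < 3)%N -> (3 %| 3 * m + i)%N = false.
    by move=> i3; apply/negbTE/negP => /dvdnP [l]; lia.
  by rewrite !nd// !if_same !addr0.
- have -> : (3 * m + 1 - 1 = 3 * m)%N by lia.
  rewrite nd// add0r ifF; last by lia.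
  rewrite dvdn_mulr// mulKn//; case: ltnP => h; first by rewrite addr0.
  have -> : (3 * m + 1 - 2 = 3 * m.-1 + 2)%N by lia.
  rewrite ifF ?addr0//; apply/negbTE/negP => /dvdnP [l]; lia.
- have -> : (3 * m + 2 - 1 = 3 * m + 1)%N by lia.
  have -> : (3 * m + 2 - 2 = 3 * m)%N by lia.
  by rewrite !nd// if_same !add0r ifF ?dvdn_mulr ?mulKn//; lia.
Qed.

Lemma sec3_dissect (A B C : fps) :
  let F := dil 3 A + q * dil 3 B + q ^+ 2 * dil 3 C in
  [/\ sec 3 0 F = A, sec 3 1 F = B & sec 3 2 F = C].
Proof.
split; rewrite !secD -[q * dil _ _]/(q ^+ 1 * dil 3 B).
- by rewrite (@sec_qnM_wrap _ _ 1)// (@sec_qnM_wrap _ _ 2)// !sec_dil//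
    !mulr0 !addr0.
- by rewrite (@sec_qnM _ _ 1)// (@sec_qnM_wrap _ _ 2)// !sec_dil//
    mulr0 addr0 add0r.
- by rewrite (@sec_qnM _ _ 1)// (@sec_qnM _ _ 2)// !sec_dil// !add0r.
Qed.

Lemma sec3M F G :
  [/\ sec 3 0 (F * G) = sec 3 0 F * sec 3 0 G
         + q * (sec 3 1 F * sec 3 2 G + sec 3 2 F * sec 3 1 G),
       sec 3 1 (F * G) = sec 3 0 F * sec 3 1 G + sec 3 1 F * sec 3 0 G
         + q * (sec 3 2 F * sec 3 2 G)
     & sec 3 2 (F * G) = sec 3 0 F * sec 3 2 G + sec 3 1 F * sec 3 1 G
         + sec 3 2 F * sec 3 0 G].
Proof.
have -> : F * G = dil 3 (sec 3 0 F * sec 3 0 G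
         + q * (sec 3 1 F * sec 3 2 G + sec 3 2 F * sec 3 1 G))
   + q * dil 3 (sec 3 0 F * sec 3 1 G + sec 3 1 F * sec 3 0 G
         + q * (sec 3 2 F * sec 3 2 G))
   + q ^+ 2 * dil 3 (sec 3 0 F * sec 3 2 G + sec 3 1 F * sec 3 1 G
         + sec 3 2 F * sec 3 0 G).
  rewrite {1}(dissect3 F) {1}(dissect3 G) !(rmorphD, rmorphM) /= dilq//.
  by ring.
exact: sec3_dissect.
Qed.

(* The product of F over the three substitutions of a cube root of q. *)
Definition norm3 (F : fps) : fps :=
  sec 3 0 F ^+ 3 + q * sec 3 1 F ^+ 3 + q ^+ 2 * sec 3 2 F ^+ 3
  - 3%:R * q * (sec 3 0 F * sec 3 1 F * sec 3 2 F).

(** With x^3 = q, [norm3] is the determinant of multiplication by A + x B + x^2 C. Its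
    multiplicativity is a polynomial identity in the six sections, so no root of unity has to be
    adjoined. *)
Lemma norm3M F G : norm3 (F * G) = norm3 F * norm3 G.
Proof. by rewrite /norm3; have [-> -> ->] := sec3M F G; ring. Qed.

Lemma norm3_dissect (A B C : fps) :
  norm3 (dil 3 A + q * dil 3 B + q ^+ 2 * dil 3 C)
  = A ^+ 3 + q * B ^+ 3 + q ^+ 2 * C ^+ 3 - 3%:R * q * (A * B * C).
Proof. by rewrite /norm3; have [-> -> ->] := sec3_dissect A B C. Qed.

Lemma norm3_dil A : norm3 (dil 3 A) = A ^+ 3.
Proof.
have := norm3_dissect A 0 0.
by rewrite !rmorph0 !mulr0 !addr0 => ->; ring.
Qed.

Lemma norm3_eqmod M F G : eqmod (3 * M) F G -> eqmod M (norm3 F) (norm3 G).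
Proof.
move=> h; have sh j : (j < 3)%N -> eqmod M (sec 3 j F) (sec 3 j G).
  by move=> j3 i iM; rewrite !coef_sec h//; lia.
have s3 j : (j < 3)%N -> eqmod M (sec 3 j F ^+ 3) (sec 3 j G ^+ 3).
  by move=> j3; apply/eqmodX/sh.
have s0 := sh 0%N isT; have s1 := sh 1%N isT; have s2 := sh 2%N isT.
apply: eqmodB; last by apply: eqmodM => //; apply: eqmodM => //; apply: eqmodM.
apply: eqmodD; last by apply: eqmodM => //; apply: s3.
by apply: eqmodD; [apply: s3 | apply: eqmodM => //; apply: s3].
Qed.

Lemma norm3_1 : norm3 1 = 1.
Proof. by rewrite -(rmorph1 (dil 3)) norm3_dil expr1n rmorph1. Qed.

Lemma norm3X F k : norm3 (F ^+ k) = norm3 F ^+ k.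
Proof.
by elim: k => [|k IH]; rewrite ?expr0 ?norm3_1// !exprS norm3M IH.
Qed.

Lemma norm3_prod (I : Type) (r : seq I) (P : pred I) (F : I -> fps) :
  norm3 (\prod_(i <- r | P i) F i) = \prod_(i <- r | P i) norm3 (F i).
Proof. exact: (big_morph norm3 norm3M norm3_1). Qed.

(** Let x run over the three cube roots of q. If 3 divides m, then x^m is always q^(m/3); otherwise
    x^m runs over the cube roots of q^m, and the product of the 1 - x^m is 1 - q^m. *)
Lemma norm3_1Bqn m :
  norm3 (1 - q ^+ m) = if (3 %| m)%N then (1 - q ^+ (m %/ 3)) ^+ 3 else 1 - q ^+ m.
Proof.
have [k [j [-> j3]]] : exists k j, m = (3 * k + j)%N /\ (j < 3)%N.
  by exists (m %/ 3)%N, (m %% 3)%N; rewrite ltn_mod {1}(divn_eq m 3) mulnC.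
have qE : q ^+ (3 * k) = dil 3 (q ^+ k) by rewrite rmorphXn /= dilq// exprM.
have nd i : (0 < i < 3)%N -> (3 %| 3 * k + i)%N = false.
  by move=> i3; apply/negbTE/negP => /dvdnP [l]; lia.
case: j j3 => [|[|[|]]]// _.
- rewrite addn0 dvdn_mulr// mulKn// qE.
  by rewrite -(rmorph1 (dil 3)) -rmorphB norm3_dil rmorph1.
- rewrite nd// exprD qE expr1.
  have := norm3_dissect 1 (- q ^+ k) 0.
  rewrite rmorph1 rmorphN rmorph0 /= !mulr0 addr0 mulrN (mulrC q) => ->.
  by rewrite -qE mulnC exprM; ring.
- rewrite nd// exprD qE.
  have := norm3_dissect 1 0 (- q ^+ k).
  rewrite rmorph1 rmorphN rmorph0 /= !mulr0 addr0 mulrN (mulrC (q ^+ 2)) => ->.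
  by rewrite -qE mulnC exprM; ring.
Qed.

(** * Infinite products *)

(** The coefficient of q^n is read from the factors of index at most n. Under [tends1] this is the
    infinite product, since factor j is 1 + O(q^(j+1)). *)
Definition iprod (u : nat -> fps) : fps :=
  Fps (fun n => coef (\prod_(j < n.+1) u j) n).

Definition tends1 (u : nat -> fps) := forall j, eqmod j.+1 (u j) 1.

Lemma prod_tail u M N : tends1 u -> (M <= N)%N ->
  eqmod M (\prod_(j < N) u j) (\prod_(j < M) u j).
Proof.
move=> hu MN; rewrite -!(big_mkord predT u) (@big_cat_nat _ _ _ M)//.
rewrite -[Y in eqmod _ _ Y]mulr1; apply: eqmodM => //.
have E1 : \prod_(M <= i < N) 1 = 1 :> fps by rewrite big1_eq.
rewrite -[Y in eqmod _ _ Y]E1 {E1}.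
rewrite big_seq_cond [Y in eqmod _ _ Y]big_seq_cond; apply: eqmod_prod => i.
rewrite mem_index_iota andbT => /andP[Mi _].
by apply: (eqmod_le _ (hu i)); lia.
Qed.

Lemma iprodE u M N : tends1 u -> (M <= N)%N ->
  eqmod M (iprod u) (\prod_(j < N) u j).
Proof.
move=> hu MN i iM; have iN : (i < N)%N by lia.
by rewrite [RHS](prod_tail hu iN (ltnSn i)).
Qed.

Lemma eq_iprod u v : u =1 v -> iprod u = iprod v.
Proof. by move=> uv; apply: fpsP => n /=; congr coef; apply: eq_bigr. Qed.

Lemma iprodM u v : tends1 u -> tends1 v ->
  iprod (fun j => u j * v j) = iprod u * iprod v.
Proof.
move=> hu hv; apply: eqmod_eq => M.
have huv : tends1 (fun j => u j * v j).
  by move=> j; rewrite -[Y in eqmod _ _ Y]mulr1; apply: eqmodM.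
apply: (eqmod_trans (iprodE huv (leqnn M))); rewrite big_split.
by apply/eqmod_sym/eqmodM; apply: iprodE.
Qed.

Lemma prod_split (u : nat -> fps) m N :
  \prod_(i < m * N) u i = \prod_(r < m) \prod_(j < N) u (m * j + r)%N.
Proof.
elim: N => [|N IH]; first by rewrite muln0 big_ord0 big1// => i; rewrite big_ord0.
rewrite mulnSr big_split_ord /= IH -big_split; apply: eq_bigr => r _.
by rewrite big_ord_recr.
Qed.

Lemma iprod_split u m : (0 < m)%N -> tends1 u ->
  iprod u = \prod_(r < m) iprod (fun j => u (m * j + r)%N).
Proof.
move=> m0 hu; apply: eqmod_eq => M; have mM : (M <= m * M)%N by nia.
apply: (eqmod_trans (iprodE hu mM)); rewrite prod_split.
apply: eqmod_prod => r _; apply/eqmod_sym/iprodE => // j.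
by apply: (eqmod_le _ (hu _)); nia.
Qed.

Lemma dil_eqmod k M F G : (0 < k)%N -> eqmod M F G -> eqmod M (dil k F) (dil k G).
Proof.
move=> k0 h i iM; rewrite !coef_dil; case: ifP => // _; apply: h.
by have := leq_div i k; lia.
Qed.

(** In q-Pochhammer notation this is (-c q^r; q^m)_oo; only c = 1 and c = -1 occur. *)
Definition fac (c : fps) (m r : nat) : fps :=
  iprod (fun j => 1 + c * q ^+ (m * j + r)).

Lemma fac_tends1 c m r : (0 < m)%N -> (0 < r)%N ->
  tends1 (fun j => 1 + c * q ^+ (m * j + r)).
Proof.
move=> m0 r0 j; rewrite -[Y in eqmod _ _ Y]addr0; apply: eqmodD => //.
by rewrite mulrC; apply: eqmodqn0; nia.
Qed.

Lemma fac0 c m r : (0 < r)%N -> coef (fac c m r) 0 = 1.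
Proof.
move=> r0; rewrite /= big_ord1 muln0 coefD coef1 coefM0 coefqn.
by case: r r0 => // r _; rewrite mulr0 addr0.
Qed.

Lemma fac_sqr m r : (0 < m)%N -> (0 < r)%N ->
  fac 1 m r * fac (-1) m r = fac (-1) (2 * m) (2 * r).
Proof.
move=> m0 r0; rewrite -iprodM; try exact: fac_tends1.
apply: eq_iprod => j; have -> : (2 * m * j + 2 * r = (m * j + r) * 2)%N by lia.
by rewrite exprM; ring.
Qed.

Lemma fac_split d c m r : (0 < d)%N -> (0 < m)%N -> (0 < r)%N ->
  fac c m r = \prod_(s < d) fac c (d * m) (m * s + r).
Proof.
move=> d0 m0 r0; rewrite [LHS](iprod_split d0); last exact: fac_tends1.
apply: eq_bigr => s _; apply: eq_iprod => j; congr (1 + c * q ^+ _); lia.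
Qed.

Lemma dil_fac (c : int) k m r : (0 < k)%N -> (0 < m)%N -> (0 < r)%N ->
  dil k (fac c%:~R m r) = fac c%:~R (k * m) (k * r).
Proof.
move=> k0 m0 r0; apply: eqmod_eq => M.
apply: (eqmod_trans (dil_eqmod k0 (iprodE (fac_tends1 _ m0 r0) (leqnn M)))).
rewrite rmorph_prod; apply: eqmod_sym.
have km0 : (0 < k * m)%N by nia.
have kr0 : (0 < k * r)%N by nia.
apply: (eqmod_trans (iprodE (fac_tends1 _ km0 kr0) (leqnn M))).
apply: eqmod_prod => j _.
rewrite rmorphD rmorph1 rmorphM rmorphXn /= dilq// -exprM rmorph_int.
by rewrite -mulnA -mulnDr.
Qed.

Definition euler (k : nat) : fps := fac (-1) k k.

Lemma euler0 k : (0 < k)%N -> coef (euler k) 0 = 1.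
Proof. exact: fac0. Qed.

Lemma euler_unit k : (0 < k)%N -> euler k \is a GRing.unit.
Proof. by move=> k0; apply/fps_unitP/euler0. Qed.

Lemma eulerE k M N : (0 < k)%N -> (M <= N.+1)%N ->
  eqmod M (euler k) (\prod_(j < N) (1 - q ^+ (k * j.+1))).
Proof.
move=> k0 MN; have h := fac_tends1 (-1) k0 k0.
apply: (eqmod_trans (iprodE h MN)); rewrite big_ord_recr /=.
rewrite -[Y in eqmod _ _ Y]mulr1; apply: eqmodM.
  by apply: eqmod_prod => j _; rewrite mulN1r mulnSr.
rewrite -[Y in eqmod _ _ Y]addr0; apply: eqmodD => //.
by rewrite mulrC; apply: eqmodqn0; nia.
Qed.

Lemma dil_euler j k : (0 < j)%N -> (0 < k)%N -> dil j (euler k) = euler (j * k).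
Proof. by move=> j0 k0; rewrite /euler -[-1]/(-1)%:~R dil_fac. Qed.

(** The norm fixes the factors 1 - q^(kj) with j prime to 3 and turns the factor j = 3i into (1 -
    q^(ki))^3. Hence the norm of f_k is (f_k/f_(3k)) f_k^3. *)
Lemma norm3_euler k : (0 < k)%N -> ~~ (3 %| k)%N ->
  norm3 (euler k) * euler (3 * k) = euler k ^+ 4.
Proof.
move=> k0 k3; apply: eqmod_eq => M; apply: eqmod_sym.
pose T d N := \prod_(j < N) (1 - q ^+ (d * j.+1)).
have eT d N L : (0 < d)%N -> (L <= N)%N -> eqmod L (euler d) (T d N).
  by move=> d0 LN; apply: eulerE => //; lia.
have k30 : (0 < 3 * k)%N by lia.
have M3 : (M <= 3 * M)%N by lia.
(* The norm needs 3M coefficients to give M, and 3M factors also group evenly by index modulo 3. *)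
apply: (@eqmod_trans _ _ (T k (3 * M)%N * T k M ^+ 3)).
  by rewrite exprS; apply: eqmodM; [|apply: eqmodX]; apply: eT.
apply: eqmod_sym; apply: (@eqmod_trans _ _ (norm3 (T k (3 * M)%N) * T (3 * k)%N M)).
  by apply: eqmodM; [apply: norm3_eqmod|]; apply: eT.
rewrite norm3_prod /T.
rewrite (prod_split (fun j => norm3 (1 - q ^+ (k * j.+1)))).
rewrite (prod_split (fun j => 1 - q ^+ (k * j.+1))).
rewrite !big_ord_recr !big_ord0 /= !mul1r -prodrXl -!big_split /=.
have cop : coprime 3 k by rewrite prime_coprime.
have Nn j r : ((r.+1) %% 3 != 0)%N ->
    norm3 (1 - q ^+ (k * (3 * j + r).+1)) = 1 - q ^+ (k * (3 * j + r).+1).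
  move=> r3; rewrite norm3_1Bqn Gauss_dvdr// ifF//.
  by apply/negbTE; rewrite /dvdn -addnS mulnC modnMDl.
rewrite (_ : \prod_(i < M) _ = \prod_(i < M) ((1 - q ^+ (k * (3 * i + 0).+1)) *
  (1 - q ^+ (k * (3 * i + 1).+1)) * (1 - q ^+ (k * (3 * i + 2).+1)) *
  (1 - q ^+ (k * i.+1)) ^+ 3))//.
apply: eq_bigr => j _; rewrite (Nn _ 0%N)// (Nn _ 1%N)//.
have e3 : (k * (3 * j + 2).+1 = 3 * (k * j.+1))%N by lia.
by rewrite norm3_1Bqn e3 dvdn_mulr// mulKn// mulrAC mulnA.
Qed.

Lemma norm3_euler3 k : (0 < k)%N -> norm3 (euler (3 * k)) = euler k ^+ 3.
Proof. by move=> k0; rewrite -dil_euler// norm3_dil. Qed.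

(** * Theta series and the Jacobi triple product *)

Definition ibox (N : nat) : seq int := [seq i%:Z - N%:Z | i <- iota 0 (2 * N).+1].

Lemma mem_ibox N k : (k \in ibox N) = (`|k| <= N)%N.
Proof.
apply/mapP/idP => [[i]|kN]; first by rewrite mem_iota => h ->; lia.
by exists (absz (k + N%:Z)); rewrite ?mem_iota; lia.
Qed.

Lemma ibox_uniq N : uniq (ibox N).
Proof. by rewrite map_inj_uniq ?iota_uniq// => i j; lia. Qed.

Lemma sum_bij (I J : eqType) (r : seq I) (s : seq J) (A : pred I) (B : pred J)
    (h : I -> J) (g : J -> I) (F : I -> int) (G : J -> int) :
  uniq r -> uniq s ->
  (forall i, i \in r -> A i -> [/\ h i \in s, B (h i), g (h i) = i & F i = G (h i)]) ->
  (forall j, j \in s -> B j -> [/\ g j \in r, A (g j) & h (g j) = j]) ->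
  \sum_(i <- r | A i) F i = \sum_(j <- s | B j) G j.
Proof.
move=> ur us hP gP; rewrite -big_filter -[RHS]big_filter.
rewrite (perm_big (map h (filter A r))) /=; last first.
  apply: uniq_perm; first exact: filter_uniq.
    rewrite map_inj_in_uniq ?filter_uniq// => i i'.
    rewrite !mem_filter => /andP[Ai ri] /andP[Ai' ri'] E.
    by have [_ _ <- _] := hP i ri Ai; rewrite E; have [_ _ -> _] := hP i' ri' Ai'.
  move=> j; rewrite mem_filter; apply/andP/mapP => [[Bj sj]|[i]].
    by have [rg Ag hg] := gP j sj Bj; exists (g j); rewrite ?mem_filter ?Ag.
  by rewrite mem_filter => /andP[Ai ri] ->; have [] := hP i ri Ai.
rewrite big_map big_seq [RHS]big_seq; apply: eq_bigr => i.
by rewrite mem_filter => /andP[Ai ri]; have [] := hP i ri Ai.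
Qed.

(** The sum of w(k) q^(t k) over all integers k. Searching only |k| <= n for the coefficient of q^n
    is exhaustive when |k| <= t k, which is why this bound accompanies every exponent function
    below. *)
Definition theta (w : int -> int) (t : int -> nat) : fps :=
  Fps (fun n => \sum_(k <- ibox n | t k == n) w k).

Lemma coef_theta w t n N : (forall k, `|k| <= t k)%N -> (n <= N)%N ->
  coef (theta w t) n = \sum_(k <- ibox N | t k == n) w k.
Proof.
move=> ht nN; apply: (@sum_bij _ _ _ _ _ _ id id); rewrite ?ibox_uniq//.
  by move=> k; rewrite !mem_ibox => kn tk; split => //; lia.
move=> k; rewrite !mem_ibox => _ /eqP tk; split; rewrite ?tk//.
by have := ht k; lia.
Qed.

Lemma thetaE w t N : (forall k, `|k| <= t k)%N ->
  eqmod N.+1 (theta w t) (\sum_(k <- ibox N) (w k)%:~R * q ^+ t k).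
Proof.
move=> ht n nN; rewrite (@coef_theta _ _ _ N)// coef_sum.
rewrite big_mkcond; apply: eq_bigr => k _; rewrite mulrC coefqnM eq_sym.
have -> m (c : int) : coef c%:~R m = if m == 0%N then c else 0.
  case: c => c; first by rewrite coef_nat natz.
  by rewrite NegzE mulrNz coefN coef_nat natz; case: ifP; rewrite ?oppr0.
case: (ltngtP n (t k)) => [h|h|->] //; last by rewrite subnn eqxx.
by rewrite ifF//; apply/negbTE; lia.
Qed.

(** * Gaussian binomial coefficients *)

Section GaussBinomial.

Variable Q : fps.

Fixpoint gbin (n i : nat) : fps :=
  match n, i with
  | _, 0 => 1
  | 0, _.+1 => 0
  | n'.+1, i'.+1 => gbin n' i' + Q ^+ i'.+1 * gbin n' i'.+1
  end.

Lemma gbin0 n : gbin n 0 = 1. Proof. by case: n. Qed.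

Lemma gbin_small n i : (n < i)%N -> gbin n i = 0.
Proof.
elim: n i => [|n IH] [|i]//= ni.
by rewrite !IH//; try lia; rewrite mulr0 addr0.
Qed.

Lemma gbinS n i : gbin n.+1 i.+1 = gbin n i + Q ^+ i.+1 * gbin n i.+1.
Proof. by []. Qed.

(** The second q-Pascal rule; the first one is the definition. *)
Lemma gbinS' n i : (i <= n)%N ->
  gbin n.+1 i.+1 = Q ^+ (n - i) * gbin n i + gbin n i.+1.
Proof.
elim: n i => [|n IH] [|i]// ni.
- by rewrite /= expr0; ring.
- have E := IH 0%N isT; rewrite gbin0 subn0 mulr1 in E.
  rewrite gbinS gbin0 expr1 {1}E subn0 mulr1 (gbinS n 0) gbin0 expr1 exprS; ring.
- rewrite gbinS; case: (ltngtP i.+1 n.+1) => [h|h|[->]]; try lia; last first.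
    by rewrite subnn !(@gbin_small _ n.+2)// !mulr0 !addr0 mul1r.
  rewrite {1}IH; last by lia.
  rewrite {1}IH; last by lia.
  rewrite !gbinS subSS (_ : n - i = (n - i.+1).+1)%N; last by lia.
  have -> : Q ^+ i.+2 = Q * Q ^+ i.+1 by rewrite exprS.
  by rewrite exprS; ring.
Qed.

Definition qfact n := \prod_(j < n) (1 - Q ^+ j.+1).

Lemma gbin_qfact n i : (i <= n)%N ->
  gbin n i * (qfact i * qfact (n - i)) = qfact n.
Proof.
elim: n i => [|n IH] [|i]// ni; rewrite ?gbin0 ?subn0 /qfact ?big_ord0 ?mul1r//.
rewrite -/(qfact i.+1) -/(qfact (n.+1 - i.+1)) -/(qfact n.+1) subSS.
have qS m : qfact m.+1 = qfact m * (1 - Q ^+ m.+1) by rewrite /qfact big_ord_recr.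
rewrite gbinS; case: (ltngtP i n) => [h|h|->]; try lia; last first.
  rewrite (@gbin_small n n.+1)// mulr0 addr0 subnn.
  by rewrite qS mulrAC mulrA -{2}(IH n)// subnn; ring.
have e1 := IH i ni; have e2 := IH i.+1 h.
have en : (n - i = (n - i.+1).+1)%N by lia.
(* From 1 - Q^(n+1) = (1 - Q^(i+1)) + Q^(i+1) (1 - Q^(n-i)), matching the two terms of the q-Pascal
   rule. *)
have -> : qfact n.+1 = qfact n * (1 - Q ^+ i.+1) +
    Q ^+ i.+1 * (1 - Q ^+ (n - i)) * qfact n.
  rewrite qS; have -> : (n.+1 = i.+1 + (n - i))%N by lia.
  by rewrite (exprD Q i.+1); ring.
rewrite -{1}e1 -{1}e2 en !qS; ring.
Qed.

(** Both q-Pascal rules combined. One induction step of the finite triple product raises the upper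
    index by two, and its two new factors expand into exactly these three kinds of terms. *)
Lemma gbinSS N i : (i <= N.+2)%N ->
  gbin N.+2 i = gbin N i * Q ^+ i
    + (if i is j.+1 then gbin N j * (1 + Q ^+ N.+1) else 0)
    + (if i is j.+2 then gbin N j * Q ^+ (N - j) else 0).
Proof.
case: i => [|[|i]] iN.
- by rewrite !gbin0 expr0 !addr0 mulr1.
- by rewrite gbinS' // gbinS subn0 !gbin0 expr1; ring.
- rewrite gbinS'// !gbinS subSS.
  have -> : (N.+1 = (N - i) + i.+1)%N by lia.
  by rewrite (exprD Q (N - i)); ring.
Qed.

End GaussBinomial.

Arguments gbin : simpl never.

(** * The Jacobi triple product *)

Section JacobiTripleProduct.

(** The exponent is t k = m k (k-1)/2 + l k, given by its recursion so that no halving appears; c is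
    a sign. *)
Variables (c : int) (m l : nat) (t : int -> nat).
Hypotheses (cc : c * c = 1) (l_gt0 : (0 < l)%N) (lm : (l < m)%N).
Hypothesis t_step : forall k : int, (t (k + 1))%:Z = (t k)%:Z + m%:Z * k + l%:Z.
Hypothesis t0 : t 0 = 0%N.
Hypothesis t_ge : forall k : int, (`|k| <= t k)%N.

Let s : fps := c%:~R.
Let Q : fps := q ^+ m.

Let ss : s * s = 1. Proof. by rewrite -rmorphM cc. Qed.

(** The finite form of the identity, with k = i - n. The sign s^k is written s^(n+i), which is the
    same by parity, to keep the exponent natural. *)
Lemma triple_product_finite n :
  \prod_(j < n) ((1 + s * q ^+ (m * j + (m - l))) * (1 + s * q ^+ (m * j + l)))
  = \sum_(i < (2 * n).+1) s ^+ (n + i) * gbin Q (2 * n) i * q ^+ t (i%:Z - n%:Z).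
Proof.
elim: n => [|n IH].
  by rewrite big_ord0 big_ord1 /= subrr t0 !expr0 !mulr1.
rewrite big_ord_recr IH /= {IH}.
set N := (2 * n)%N; have -> : (2 * n.+1 = N.+2)%N by rewrite /N; lia.
set u := fun i : nat => s ^+ (n + i) * gbin Q N i * q ^+ t (i%:Z - n%:Z).
under eq_bigr => i _ do rewrite -/(u i).
have -> : (1 + s * q ^+ (m * n + (m - l))) * (1 + s * q ^+ (m * n + l)) =
    s * q ^+ (m * n + (m - l)) + (1 + Q ^+ N.+1) + s * q ^+ (m * n + l).
  have -> : Q ^+ N.+1 = q ^+ (m * n + (m - l)) * q ^+ (m * n + l).
    by rewrite -exprM -exprD; congr (_ ^+ _); rewrite /N; nia.
  by ring: ss.
pose A (i : nat) := s ^+ (n.+1 + i) * q ^+ t (i%:Z - n.+1%:Z).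
rewrite [RHS](_ : _ = \sum_(i < N.+3) (A i * (gbin Q N i * Q ^+ i))
   + \sum_(i < N.+3) (A i * (if val i is j.+1 then gbin Q N j * (1 + Q ^+ N.+1) else 0))
   + \sum_(i < N.+3) (A i * (if val i is j.+2 then gbin Q N j * Q ^+ (N - j) else 0))); last first.
  rewrite -!big_split; apply: eq_bigr => i _ /=.
  rewrite gbinSS /A; last by have := ltn_ord i; lia.
  by case: i => [[|[|i]] ?] /=; ring.
rewrite 2!mulrDr; congr (_ + _ + _).
- rewrite mulr_suml [RHS]big_ord_recr [in RHS]big_ord_recr /= !gbin_small//.
  rewrite !mul0r !mulr0 !addr0.
  apply: eq_bigr => i _; rewrite /u /A.
  have E : q ^+ t (i%:Z - n.+1%:Z) * Q ^+ i =
      q ^+ t (i%:Z - n%:Z) * q ^+ (m * n + (m - l)).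
    rewrite -exprM -!exprD; congr (_ ^+ _).
    have := t_step (i%:Z - n.+1%:Z).
    by rewrite (_ : i%:Z - n.+1%:Z + 1 = i%:Z - n%:Z); [nia | lia].
  by rewrite addSn exprS; ring: E.
- rewrite mulr_suml [RHS]big_ord_recl [in RHS]big_ord_recr /= mulr0 add0r.
  rewrite !gbin_small//= mul0r mulr0 addr0; apply: eq_bigr => i _; rewrite /u /A.
  have -> : (lift ord0 (widen_ord (leqnSn N.+1) i))%:Z - n.+1%:Z = i%:Z - n%:Z.
    by rewrite lift0 /=; lia.
  by rewrite /bump /= add1n addSn addnS !exprS; ring: ss.
- rewrite mulr_suml [RHS]big_ord_recl [in RHS]big_ord_recl /= !mulr0 !add0r.
  apply: eq_bigr => i _; rewrite /u /A.
  rewrite /bump /= !add1n.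
  have E : q ^+ t (i.+2%:Z - n.+1%:Z) * Q ^+ (N - i) =
      q ^+ t (i%:Z - n%:Z) * q ^+ (m * n + l).
    rewrite -exprM -!exprD; congr (_ ^+ _).
    have := t_step (i%:Z - n%:Z).
    rewrite (_ : i%:Z - n%:Z + 1 = i.+2%:Z - n.+1%:Z); last by lia.
    by have := ltn_ord i; rewrite /N; nia.
  by rewrite addSn !addnS !exprS; ring: E ss.
Qed.

Let m_gt0 : (0 < m)%N. Proof. by lia. Qed.

Lemma qfact_euler a M : (M <= a.+1)%N -> eqmod M (euler m) (qfact Q a).
Proof.
move=> Ma; apply: (eqmod_trans (eulerE m_gt0 Ma)).
by apply: eqmod_prod => j _; rewrite -exprM.
Qed.

(** When i and N - i are large, the quotient formula gives gbin f_m^2 = f_m to the stated precision;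
    one unit f_m is then divided out. *)
Lemma gbin_euler N i M : (i <= N)%N -> (M <= i.+1)%N -> (M <= (N - i).+1)%N ->
  eqmod M (gbin Q N i * euler m) 1.
Proof.
move=> iN Mi MNi; set E := euler m.
have h : eqmod M (gbin Q N i * (E * E)) E.
  apply: (@eqmod_trans _ _ (gbin Q N i * (qfact Q i * qfact Q (N - i)))).
    by apply: eqmodM => //; apply: eqmodM; apply: qfact_euler.
  by rewrite gbin_qfact//; apply/eqmod_sym/qfact_euler; lia.
have uE := euler_unit m_gt0.
have := eqmodM h (@eqmod_refl M E^-1).
by rewrite mulrV// mulrA mulrK.
Qed.

Lemma eqmod_shift a b M F G : (M <= a + b)%N -> eqmod b F G ->
  eqmod M (F * q ^+ a) (G * q ^+ a).
Proof.
move=> Mab h i iM; rewrite ![_ * q ^+ a]mulrC !coefqnM; case: ltnP => // ai.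
by apply: h; lia.
Qed.

Theorem triple_product :
  fac s m (m - l) * fac s m l * euler m = theta (fun k => c ^+ absz k) t.
Proof.
apply: eqmod_eq => n; have ml0 : (0 < m - l)%N by lia.
apply: (@eqmod_trans _ _ (\prod_(j < n) ((1 + s * q ^+ (m * j + (m - l))) *
  (1 + s * q ^+ (m * j + l))) * euler m)).
  rewrite big_split; apply: eqmodM => //.
  by apply: eqmodM; apply: iprodE => //; apply: fac_tends1.
rewrite triple_product_finite.
apply: eqmod_sym; have h := eqmod_le (leqnSn n) (@thetaE (fun k => c ^+ absz k) t n t_ge).
apply: (eqmod_trans h) => {h}.
rewrite /ibox big_map -{1}[(2 * n).+1]subn0 -/(index_iota 0 _) big_mkord mulr_suml.
apply: eqmod_sum => i _; have i2n := ltn_ord i.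
have -> : (c ^+ absz (i%:Z - n%:Z))%:~R = s ^+ (n + i) :> fps.
  rewrite rmorphXn /= -/s.
  have [d ->] : exists d, (n + i = absz (i%:Z - n%:Z) + 2 * d)%N.
    by exists (minn i n); lia.
  by rewrite exprD exprM expr2 ss expr1n mulr1.
rewrite -!mulrA [q ^+ _ * _]mulrC; apply: eqmodM => //.
rewrite mulrA -[Y in eqmod _ Y]mul1r.
(* Near the ends of the range the q-binomial is far from its limit. The factor q^t(i-n) makes up for
   it: min(i, 2n-i) + |i-n| = n and |i-n| <= t(i-n). *)
apply/eqmod_sym/(@eqmod_shift _ (minn i (2 * n - i)).+1).
  by have := t_ge (i%:Z - n%:Z); lia.
by apply: gbin_euler; lia.
Qed.

End JacobiTripleProduct.

(** * Reindexing and splitting theta series *)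

Lemma eq_theta w w' t t' : w =1 w' -> t =1 t' -> theta w t = theta w' t'.
Proof. by move=> /funext -> /funext ->. Qed.

Lemma theta_opp w t : theta (fun k => - w k) t = - theta w t.
Proof. by apply: fpsP => n; rewrite coefN /= sumrN. Qed.

Lemma theta_reindex (s : int -> int) w t :
  (forall k, s (s k) = k) ->
  (forall k, `|k| <= t k)%N -> (forall k, `|k| <= t (s k))%N ->
  theta (fun k => w (s k)) (fun k => t (s k)) = theta w t.
Proof.
move=> sK tb tsb; apply: fpsP => n.
apply: (@sum_bij _ _ _ _ _ _ s s); rewrite ?ibox_uniq// => k.
  rewrite !mem_ibox => kn /eqP tk; split; rewrite ?sK ?tk//.
  by have := tb (s k); lia.
rewrite !mem_ibox => kn /eqP tk; split; rewrite ?sK ?tk//.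
by have := tsb (s k); rewrite sK; lia.
Qed.

Lemma theta_shift w t a m : (0 < m)%N -> (forall k, `|k| <= t k)%N ->
  theta w (fun k => a + m * t k)%N = q ^+ a * dil m (theta w t).
Proof.
move=> m0 tb; have tb' k : (`|k| <= a + m * t k)%N by have := tb k; nia.
apply: fpsP => n; rewrite coefqnM coef_dil (@coef_theta _ _ n n)//.
case: ltnP => an; first by rewrite big1// => k; lia.
case: ifP => [/dvdnP [d dE]|nd]; last first.
  rewrite big1// => k /eqP E; move: nd; rewrite -E addKn dvdn_mulr//.
rewrite (@coef_theta _ _ _ n)//; last first.
  by rewrite (leq_trans (leq_div _ _))// leq_subr.
apply: eq_bigl => k; rewrite dE mulnK//.
by apply/eqP/eqP => [|->]; [nia | lia].
Qed.

Lemma theta_split2 w t : (forall k, `|k| <= t k)%N ->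
  theta w t = theta (fun k => w (2 * k)) (fun k => t (2 * k))
            + theta (fun k => w (2 * k + 1)) (fun k => t (2 * k + 1)).
Proof.
move=> tb; apply: fpsP => n; rewrite coefD /= .
rewrite (bigID (fun k : int => (k %% 2)%Z == 0)) /=; congr (_ + _).
  apply: (@sum_bij _ _ _ _ _ _ (fun k => (k %/ 2)%Z) (fun k => 2 * k));
    rewrite ?ibox_uniq// => k; rewrite !mem_ibox.
    move=> kn /andP[tk /eqP k2]; have E : 2 * (k %/ 2)%Z = k by lia.
    by split; rewrite ?E//; lia.
  by move=> kn /eqP tk; have := tb (2 * k); split; rewrite ?tk ?eqxx; lia.
apply: (@sum_bij _ _ _ _ _ _ (fun k => (k %/ 2)%Z) (fun k => 2 * k + 1));
  rewrite ?ibox_uniq// => k; rewrite !mem_ibox.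
  move=> kn /andP[tk /eqP k2]; have E : 2 * (k %/ 2)%Z + 1 = k by lia.
  by split; rewrite ?E//; lia.
by move=> kn /eqP tk; have := tb (2 * k + 1); split; rewrite ?tk ?eqxx; lia.
Qed.

Lemma theta_split3 w t : (forall k, `|k| <= t k)%N ->
  theta w t = theta (fun k => w (3 * k)) (fun k => t (3 * k))
            + theta (fun k => w (3 * k + 1)) (fun k => t (3 * k + 1))
            + theta (fun k => w (3 * k - 1)) (fun k => t (3 * k - 1)).
Proof.
move=> tb; apply: fpsP => n; rewrite !coefD /= .
rewrite (bigID (fun k : int => (k %% 3)%Z == 0)) /= -addrA; congr (_ + _).
  apply: (@sum_bij _ _ _ _ _ _ (fun k => (k %/ 3)%Z) (fun k => 3 * k));
    rewrite ?ibox_uniq// => k; rewrite !mem_ibox.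
    move=> kn /andP[tk /eqP k2]; have E : 3 * (k %/ 3)%Z = k by lia.
    by split; rewrite ?E//; lia.
  by move=> kn /eqP tk; have := tb (3 * k); split; rewrite ?tk ?eqxx; lia.
rewrite (bigID (fun k : int => (k %% 3)%Z == 1)) /=; congr (_ + _).
  apply: (@sum_bij _ _ _ _ _ _ (fun k => (k %/ 3)%Z) (fun k => 3 * k + 1));
    rewrite ?ibox_uniq// => k; rewrite !mem_ibox.
    move=> kn /andP[/andP[tk _] /eqP k2].
    have E : 3 * (k %/ 3)%Z + 1 = k by lia.
    by split; rewrite ?E//; lia.
  by move=> kn /eqP tk; have := tb (3 * k + 1); split; rewrite ?tk ?eqxx; lia.
apply: (@sum_bij _ _ _ _ _ _ (fun k => ((k + 1) %/ 3)%Z) (fun k => 3 * k - 1));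
  rewrite ?ibox_uniq// => k; rewrite !mem_ibox.
  move=> kn /andP[/andP[tk /eqP k0] /eqP k1].
  have E : 3 * ((k + 1) %/ 3)%Z - 1 = k by lia.
  by split; rewrite ?E//; lia.
by move=> kn /eqP tk; have := tb (3 * k - 1); split; rewrite ?tk ?eqxx; lia.
Qed.

Definition box2 (N : nat) : seq (int * int) :=
  [seq (k, l) | k <- ibox N, l <- ibox N].

Lemma mem_box2 N k l : ((k, l) \in box2 N) = (`|k| <= N)%N && (`|l| <= N)%N.
Proof.
apply/allpairsP/andP => [[[i j] /= [hi hj [-> ->]]]|[hk hl]].
  by rewrite -!mem_ibox.
by exists (k, l); rewrite !mem_ibox.
Qed.

Lemma box2_uniq N : uniq (box2 N).
Proof. by apply: allpairs_uniq; rewrite ?ibox_uniq// => -[? ?] [? ?]. Qed.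

Definition theta1 := theta (fun=> 1).

Lemma coef_theta1M t1 t2 n :
  (forall k, `|k| <= t1 k)%N -> (forall k, `|k| <= t2 k)%N ->
  coef (theta1 t1 * theta1 t2) n
  = \sum_(p <- box2 n | (t1 p.1 + t2 p.2 == n)%N) 1.
Proof.
move=> b1 b2; rewrite (eqmodM (thetaE _ b1) (thetaE _ b2) (ltnSn n)).
rewrite mulr_suml coef_sum [RHS]big_mkcond /box2 big_allpairs; apply: eq_bigr => k _.
rewrite mulr_sumr coef_sum; apply: eq_bigr => l _.
by rewrite !mulr1z !mul1r -exprD coefqn eq_sym /=; case: eqP.
Qed.

(** * The theta functions in use: product formulas and dissections *)

Definition tsq (k : int) : nat := absz (k * k).
Definition tpsi (k : int) : nat := absz (2 * (k * k) + k).
Definition tpent (k : int) : nat := (absz (k * (3 * k + 1)))./2.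
Definition tom (k : int) : nat := absz (3 * (k * k) + 2 * k).

Lemma sq_ge (k : int) :
  (absz k)%:Z <= k * k /\ - (absz k)%:Z <= k <= (absz k)%:Z.
Proof. by split; last lia; have [h|h] := lerP 0 k; nia. Qed.

Lemma tsqE k : (tsq k)%:Z = k * k. Proof. by have := sq_ge k; rewrite /tsq /tpsi /tom; lia. Qed.
Lemma tpsiE k : (tpsi k)%:Z = 2 * (k * k) + k. Proof. by have := sq_ge k; rewrite /tsq /tpsi /tom; lia. Qed.
Lemma tomE k : (tom k)%:Z = 3 * (k * k) + 2 * k. Proof. by have := sq_ge k; rewrite /tsq /tpsi /tom; lia. Qed.
Lemma tpentE k : 2 * (tpent k)%:Z = 3 * (k * k) + k.
Proof.
have [j jE] : exists j : int, k * (3 * k + 1) = 2 * j.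
  have [j [->|->]] : exists j : int, k = 2 * j \/ k = 2 * j + 1.
    by exists (k %/ 2)%Z; lia.
  - by exists (j * (6 * j + 1)); ring.
  - by exists ((2 * j + 1) * (3 * j + 2)); ring.
by have := sq_ge k; rewrite /tpent; lia.
Qed.

Lemma tsq_ge k : (`|k| <= tsq k)%N. Proof. by have := tsqE k; have := sq_ge k; lia. Qed.
Lemma tpsi_ge k : (`|k| <= tpsi k)%N. Proof. by have := tpsiE k; have := sq_ge k; lia. Qed.
Lemma tom_ge k : (`|k| <= tom k)%N. Proof. by have := tomE k; have := sq_ge k; lia. Qed.
Lemma tpent_ge k : (`|k| <= tpent k)%N. Proof. by have := tpentE k; have := sq_ge k; lia. Qed.

(** As k runs over all integers, 2k^2 + k takes each triangular number once, so [psi] is Ramanujan's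
    psi. [pent] is P of the overview, [phim] is phi(-q), and [omega] is f(-q, -q^5) in Ramanujan's
    two-variable notation. *)
Definition psi := theta1 tpsi.
Definition phi := theta1 tsq.
Definition pent := theta1 tpent.
Definition phim := theta (fun k => (-1) ^+ absz k) tsq.
Definition omega := theta (fun k => (-1) ^+ absz k) tom.

Lemma theta1_sgn t : theta1 t = theta (fun k => 1 ^+ absz k) t.
Proof. by apply: eq_theta => // k; rewrite expr1n. Qed.

Lemma euler_split2 k : (0 < k)%N ->
  euler k = fac (-1) (2 * k) k * euler (2 * k).
Proof.
move=> k0; rewrite {1}/euler (@fac_split 2)//. rewrite !big_ord_recr big_ord0 /= mul1r.
by congr (fac _ _ _ * fac _ _ _); lia.
Qed.

(** The triple product gives psi = (-q;q^2) f_4. With f_1 = (q;q^2) f_2, the two odd products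
    combine to (q^2;q^4), and (q^2;q^4) f_4 = f_2. *)
Lemma psi_prod : psi * euler 1 = euler 2 ^+ 2.
Proof.
have -> : psi = fac 1 4 1 * fac 1 4 3 * euler 4.
  rewrite [LHS]theta1_sgn; symmetry; apply: (@triple_product 1 4 3) => //.
  - by move=> k; rewrite !tpsiE; ring.
  - exact: tpsi_ge.
have e : fac 1 2 1 = fac 1 4 1 * fac 1 4 3.
  by rewrite (@fac_split 2)// !big_ord_recr big_ord0 /= mul1r.
rewrite -e (@euler_split2 1)// (@euler_split2 2)//.
by have := @fac_sqr 2 1 isT isT; rewrite /= => f; ring: f.
Qed.

Lemma phim_prod : phim * euler 2 = euler 1 ^+ 2.
Proof.
have -> : phim = fac (-1) 2 1 * fac (-1) 2 1 * euler 2.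
  symmetry; apply: (@triple_product (-1) 2 1) => //.
  - by move=> k; rewrite !tsqE; ring.
  - exact: tsq_ge.
by rewrite (@euler_split2 1)//; ring.
Qed.

Lemma phi_phim : phi * phim = dil 2 phim ^+ 2.
Proof.
have -> : phi = fac 1 2 1 * fac 1 2 1 * euler 2.
  rewrite [LHS]theta1_sgn; symmetry; apply: (@triple_product 1 2 1) => //.
  - by move=> k; rewrite !tsqE; ring.
  - exact: tsq_ge.
have phimE : phim = fac (-1) 2 1 * fac (-1) 2 1 * euler 2.
  symmetry; apply: (@triple_product (-1) 2 1) => //.
  - by move=> k; rewrite !tsqE; ring.
  - exact: tsq_ge.
rewrite phimE !rmorphM /= dil_euler// (dil_fac (-1))//.
have := @fac_sqr 2 1 isT isT; rewrite /= => f.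
by rewrite (@euler_split2 2)//=; ring: f.
Qed.

(** The triple product gives P = f_3 (-q;q)/(-q^3;q^3), and (-q^k;q^k) = f_(2k)/f_k for k = 1 and
    3. *)
Lemma pent_prod : pent * euler 1 * euler 6 = euler 2 * euler 3 ^+ 2.
Proof.
have -> : pent = fac 1 3 1 * fac 1 3 2 * euler 3.
  rewrite [LHS]theta1_sgn; symmetry; apply: (@triple_product 1 3 2) => //.
  - by move=> k; have := tpentE k; have := tpentE (k + 1); lia.
  - exact: tpent_ge.
have e : fac 1 1 1 = fac 1 3 1 * fac 1 3 2 * fac 1 3 3.
  by rewrite (@fac_split 3)// !big_ord_recr big_ord0 /= mul1r.
have f1 := @fac_sqr 1 1 isT isT; rewrite e in f1.
have f3 := @fac_sqr 3 3 isT isT.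
rewrite -[euler 2]f1 -[euler 6]f3 /euler; ring.
Qed.

Lemma omega_prod : omega * euler 2 * euler 3 = euler 1 * euler 6 ^+ 2.
Proof.
have -> : omega = fac (-1) 6 1 * fac (-1) 6 5 * euler 6.
  symmetry; apply: (@triple_product (-1) 6 5) => //.
  - by move=> k; rewrite !tomE; ring.
  - exact: tom_ge.
rewrite (@euler_split2 1)// (@euler_split2 3)//=.
have -> : fac (-1) (2 * 1) 1 = fac (-1) 6 1 * fac (-1) 6 3 * fac (-1) 6 5.
  by rewrite (@fac_split 3)// !big_ord_recr big_ord0 /= mul1r.
by ring.
Qed.

(** Each exponent is generalised, keeping only its polynomial formula and its lower bound; the goal
    is then linear in the monomials. *)
Ltac theta_lia :=
  repeat match goal with
  | |- context [tpsi ?x] => have := tpsi_ge x; have := tpsiE x; move: (tpsi x) => ?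
  | |- context [tsq ?x] => have := tsq_ge x; have := tsqE x; move: (tsq x) => ?
  | |- context [tom ?x] => have := tom_ge x; have := tomE x; move: (tom x) => ?
  | |- context [tpent ?x] => have := tpent_ge x; have := tpentE x; move: (tpent x) => ?
  end; lia.

(** Indices 3k and 3k+1 give the terms of P(q^3) of even and odd index, the latter after k -> -k-1,
    and 3k-1 gives q psi(q^9). *)
Lemma psi_dissect3 : psi = dil 3 pent + q * dil 9 psi.
Proof.
rewrite {1}/psi /theta1 (theta_split3 _ tpsi_ge); congr (_ + _).
  rewrite /pent /theta1 (theta_split2 _ tpent_ge) rmorphD /=; congr (_ + _).
    rewrite -[dil 3 _]mul1r -(expr0 q) -theta_shift//.
      apply: eq_theta => // k /=.
      by theta_lia.
    by move=> k; have := tpent_ge (2 * k); lia.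
  have sb k : (`|k| <= tpent (2 * (- k - 1) + 1))%N.
    by have := tpent_ge (2 * (- k - 1) + 1); lia.
  have tb k : (`|k| <= tpent (2 * k + 1))%N.
    by have := tpent_ge (2 * k + 1); lia.
  rewrite -(@theta_reindex (fun k => - k - 1) _ _ _ tb sb); last by move=> k; lia.
  rewrite -[dil 3 _]mul1r -(expr0 q) -theta_shift//.
  apply: eq_theta => // k /=.
  by theta_lia.
have sb k : (`|k| <= tpsi (- k))%N by have := tpsi_ge (- k); lia.
rewrite /psi /theta1 -(@theta_reindex -%R _ _ _ tpsi_ge sb); last by move=> k; rewrite opprK.
rewrite -[q in RHS]expr1 -theta_shift//.
apply: eq_theta => // k /=.
by theta_lia.
Qed.

Lemma sgnz_odd (k : int) : (-1) ^+ absz k = (if (k %% 2)%Z == 0 then 1 else -1) :> int.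
Proof.
rewrite -signr_odd; have -> : odd (absz k) = ((k %% 2)%Z != 0) by lia.
by case: eqP.
Qed.

(** Indices 3k+1 and 3k-1 have exponents 1 + 3(3k^2 + 2k) and 1 + 3(3k^2 - 2k), with sign opposite
    to that of k; each class contributes -q omega(q^3). *)
Lemma phim_dissect3 : phim = dil 9 phim - 2%:R * q * dil 3 omega.
Proof.
rewrite {1}/phim (theta_split3 _ tsq_ge) -addrA; congr (_ + _).
  rewrite -[dil 9 _]mul1r -(expr0 q) -theta_shift; [|by []|exact: tsq_ge].
  apply: eq_theta => k /=; first by rewrite !sgnz_odd; congr (if _ then _ else _); lia.
  by theta_lia.
have E : q * dil 3 omega =
    theta (fun k => (-1) ^+ absz k) (fun k => 1 + 3 * tom k)%N.
  by rewrite (theta_shift _ _ _ tom_ge)// expr1.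
rewrite -mulrA E mulr_natl mulr2n opprD; congr (_ + _).
  rewrite -theta_opp; apply: eq_theta => k /=.
    rewrite !sgnz_odd (_ : ((3 * k + 1) %% 2)%Z == 0 = ((k %% 2)%Z != 0)); last by lia.
    by case: eqP.
  by theta_lia.
have tb k : (`|k| <= 1 + 3 * tom k)%N by have := tom_ge k; lia.
have sb k : (`|k| <= 1 + 3 * tom (- k))%N by have := tom_ge (- k); lia.
rewrite -(@theta_reindex -%R _ _ _ tb sb); last by move=> k; rewrite opprK.
rewrite -theta_opp; apply: eq_theta => k /=.
  rewrite !sgnz_odd (_ : ((3 * k - 1) %% 2)%Z == 0 = ((- k %% 2)%Z != 0)); last by lia.
  by case: eqP.
by theta_lia.
Qed.

(** An odd square is 1 + 8T with T triangular, and both roots of the square occur, whence the factor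
    2. *)
Lemma theta_sq_odd :
  theta1 (fun k => tsq (2 * k + 1)) = 2%:R * q * dil 8 psi.
Proof.
have tb k : (`|k| <= tsq (2 * k + 1))%N by have := tsq_ge (2 * k + 1); lia.
have E : q * dil 8 psi = theta1 (fun k => 1 + 8 * tpsi k)%N.
  by rewrite /theta1 (theta_shift _ _ _ tpsi_ge)// expr1.
rewrite /theta1 (theta_split2 _ tb) -mulrA E mulr_natl mulr2n; congr (_ + _).
  apply: eq_theta => // k /=.
  by theta_lia.
have tb' k : (`|k| <= 1 + 8 * tpsi k)%N by have := tpsi_ge k; lia.
have sb k : (`|k| <= 1 + 8 * tpsi (- k - 1))%N by have := tpsi_ge (- k - 1); lia.
rewrite /theta1 -(@theta_reindex (fun k => - k - 1) _ _ _ tb' sb); last by move=> k; lia.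
apply: eq_theta => // k /=.
by theta_lia.
Qed.

Lemma phi_dissect2 : phi = dil 4 phi + 2%:R * q * dil 8 psi.
Proof.
rewrite -theta_sq_odd {1}/phi /theta1 (theta_split2 _ tsq_ge); congr (_ + _).
rewrite -[dil 4 _]mul1r -(expr0 q) -theta_shift; [|by []|exact: tsq_ge].
by apply: eq_theta => // k /=; have := tsqE (2 * k); have := tsqE k; lia.
Qed.

Lemma phim_dissect2 : phim = dil 4 phi - 2%:R * q * dil 8 psi.
Proof.
rewrite -theta_sq_odd {1}/phim (theta_split2 _ tsq_ge); congr (_ + _).
  rewrite -[dil 4 _]mul1r -(expr0 q) -theta_shift; [|by []|exact: tsq_ge].
  apply: eq_theta => k /=; last by theta_lia.
  by rewrite sgnz_odd ifT//; lia.
rewrite -theta_opp; apply: eq_theta => k //=.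
by rewrite sgnz_odd ifF//; lia.
Qed.

(* With u = 4k+1 and v = 4l+1, the norm form gives
   (u^2 + 3v^2)/4 = ((u+3v)/4)^2 + 3((u-v)/4)^2, and exactly one of the two
   squares on the right is odd. *)
Lemma psi_psi3 :
  psi * dil 3 psi = dil 6 phi * dil 4 psi + q * (dil 2 phi * dil 12 psi).
Proof.
have dilE m t : (0 < m)%N -> (forall k, `|k| <= t k)%N ->
    dil m (theta1 t) = theta1 (fun k => m * t k)%N.
  by move=> m0 tb; rewrite -[LHS]mul1r -(expr0 q) -theta_shift.
have -> : q * (dil 2 phi * dil 12 psi) =
    theta1 (fun k => 1 + 2 * tsq k)%N * theta1 (fun k => 12 * tpsi k)%N.
  rewrite mulrA -[q]expr1 -(theta_shift _ _ _ tsq_ge)//.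
  by rewrite (dilE _ _ _ tpsi_ge).
rewrite !(dilE _ _ _ tpsi_ge)// !(dilE _ _ _ tsq_ge)//.
have pb m k : (0 < m)%N -> (`|k| <= m * tpsi k)%N.
  by move=> m0; have := tpsi_ge k; nia.
have sb m k : (0 < m)%N -> (`|k| <= m * tsq k)%N.
  by move=> m0; have := tsq_ge k; nia.
have sb1 k : (`|k| <= 1 + 2 * tsq k)%N by have := tsq_ge k; lia.
apply: fpsP => n; rewrite coefD.
rewrite !coef_theta1M; try by [exact: tpsi_ge | move=> k; exact: pb
  | move=> k; exact: sb | exact: sb1].
rewrite (bigID (fun p : int * int => ((p.1 - p.2) %% 2)%Z == 0)) /=; congr (_ + _).
(* Here k - l = 2d and the odd root is k + 3l + 1 = 4l + 2d + 1. It is 1 modulo 4 exactly when d is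
   even; otherwise its negative is the one written 4m + 1. *)
- pose h (p : int * int) : int * int := let d := ((p.1 - p.2) %/ 2)%Z in
    if (d %% 2)%Z == 0 then (d, p.2 + (d %/ 2)%Z) else (d, - (p.2 + (d %/ 2)%Z + 1)).
  pose g (p : int * int) : int * int :=
    let l := if (p.1 %% 2)%Z == 0 then p.2 - (p.1 %/ 2)%Z else - p.2 - (p.1 %/ 2)%Z - 1
    in (l + 2 * p.1, l).
  apply: (@sum_bij _ _ _ _ _ _ h g); rewrite ?box2_uniq// => -[x y] _.
    move=> /andP[/eqP e /eqP par]; rewrite /= in e par.
    have [j [[xE hE]|[xE hE]]] : exists j : int,
        (x = y + 4 * j /\ h (x, y) = (2 * j, y + j)) \/
        (x = y + 4 * j + 2 /\ h (x, y) = (2 * j + 1, - (y + j + 1))).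
      exists (divz (divz (x - y) 2) 2); rewrite /h /=; case: eqP => par2.
        by left; split; [lia | congr pair; lia].
      by right; split; [lia | congr pair; lia].
    + have en : (6 * tsq (2 * j) + 4 * tpsi (y + j) = n)%N.
        by move: e; rewrite xE; theta_lia.
      rewrite hE mem_box2 /= en eqxx; split => //.
        by move: en; theta_lia.
      by rewrite /g /= ifT; [congr pair; lia | lia].
    + have en : (6 * tsq (2 * j + 1) + 4 * tpsi (- (y + j + 1)) = n)%N.
        by move: e; rewrite xE; theta_lia.
      rewrite hE mem_box2 /= en eqxx; split => //.
        by move: en; theta_lia.
      by rewrite /g /= ifF; [congr pair; lia | lia].
  move=> /eqP e; rewrite /= in e.
  have [j [[xE gE]|[xE gE]]] : exists j : int,
      (x = 2 * j /\ g (x, y) = (y + 3 * j, y - j)) \/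
      (x = 2 * j + 1 /\ g (x, y) = (- y + 3 * j + 1, - y - j - 1)).
    exists (x %/ 2)%Z; rewrite /g /=; case: eqP => par2.
      by left; split; [lia | congr pair; lia].
    by right; split; [lia | congr pair; lia].
  + have en : (tpsi (y + 3 * j) + 3 * tpsi (y - j) = n)%N.
      by move: e; rewrite xE; theta_lia.
    rewrite gE mem_box2 /= en eqxx; split; last 1 first.
    * by rewrite /h /= ifT; [congr pair; lia | lia].
    * by move: en; theta_lia.
    * by lia.
  + have en : (tpsi (- y + 3 * j + 1) + 3 * tpsi (- y - j - 1) = n)%N.
      by move: e; rewrite xE; theta_lia.
    rewrite gE mem_box2 /= en eqxx; split; last 1 first.
    * by rewrite /h /= ifF; [congr pair; lia | lia].
    * by move: en; theta_lia.
    * by lia.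
(* Now d = k - l is the odd root, equal to 4m + 1 up to sign, and the even root is d + 1 + 4l. *)
- pose h (p : int * int) : int * int := let d := p.1 - p.2 in
    (((d + 1) %/ 2)%Z + 2 * p.2,
     if (d %% 4)%Z == 1 then (d %/ 4)%Z else ((- d - 1) %/ 4)%Z).
  pose g (p : int * int) : int * int :=
    if (p.1 %% 2)%Z == 1 then
      let l := ((p.1 - 1) %/ 2)%Z - p.2 in (l + 4 * p.2 + 1, l)
    else let l := (p.1 %/ 2)%Z + p.2 in (l - 4 * p.2 - 1, l).
  apply: (@sum_bij _ _ _ _ _ _ h g); rewrite ?box2_uniq// => -[x y] _.
    move=> /andP[/eqP e /eqP par]; rewrite /= in e par.
    have [j [[xE hE]|[xE hE]]] : exists j : int,
        (x = y + 4 * j + 1 /\ h (x, y) = (2 * j + 1 + 2 * y, j)) \/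
        (x = y - 4 * j - 1 /\ h (x, y) = (- 2 * j + 2 * y, j)).
      rewrite /h /=; case: eqP => par2.
        by exists ((x - y) %/ 4)%Z; left; split; [lia | congr pair; lia].
      exists ((- (x - y) - 1) %/ 4)%Z; right.
      by split; [lia | congr pair; lia].
    + have en : (1 + 2 * tsq (2 * j + 1 + 2 * y) + 12 * tpsi j = n)%N.
        by move: e; rewrite xE; theta_lia.
      rewrite hE mem_box2 /= en eqxx; split => //.
        by move: en; theta_lia.
      by rewrite /g /= ifT; [congr pair; lia | lia].
    + have en : (1 + 2 * tsq (- 2 * j + 2 * y) + 12 * tpsi j = n)%N.
        by move: e; rewrite xE; theta_lia.
      rewrite hE mem_box2 /= en eqxx; split => //.
        by move: en; theta_lia.
      by rewrite /g /= ifF; [congr pair; lia | lia].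
  move=> /eqP e; rewrite /= in e.
  have [j [[xE gE]|[xE gE]]] : exists j : int,
      (x = 2 * j + 1 /\ g (x, y) = (j + 3 * y + 1, j - y)) \/
      (x = 2 * j /\ g (x, y) = (j - 3 * y - 1, j + y)).
    exists (x %/ 2)%Z; rewrite /g /=; case: eqP => par2.
      by left; split; [lia | congr pair; lia].
    by right; split; [lia | congr pair; lia].
  + have en : (tpsi (j + 3 * y + 1) + 3 * tpsi (j - y) = n)%N.
      by move: e; rewrite xE; theta_lia.
    rewrite gE mem_box2 /= en eqxx; split; last 1 first.
    * by rewrite /h /= ifT; [congr pair; lia | lia].
    * by move: en; theta_lia.
    * by lia.
  + have en : (tpsi (j - 3 * y - 1) + 3 * tpsi (j + y) = n)%N.
      by move: e; rewrite xE; theta_lia.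
    rewrite gE mem_box2 /= en eqxx; split; last 1 first.
    * by rewrite /h /= ifF; [congr pair; lia | lia].
    * by move: en; theta_lia.
    * by lia.
Qed.

(** * Two-dissections and the norm over the square roots of q *)

Lemma sec2_dissect (A B : fps) :
  let F := dil 2 A + q * dil 2 B in sec 2 0 F = A /\ sec 2 1 F = B.
Proof.
split; rewrite !secD -[q * dil _ _]/(q ^+ 1 * dil 2 B).
- by rewrite (@sec_qnM_wrap _ _ 1)// !sec_dil// !mulr0 !addr0.
- by rewrite (@sec_qnM _ _ 1)// !sec_dil// add0r.
Qed.

Lemma dissect2 F : F = dil 2 (sec 2 0 F) + q * dil 2 (sec 2 1 F).
Proof.
apply: fpsP => n; rewrite !coefD -[q * _]/(q ^+ 1 * _) !coefqnM !coef_dil.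
rewrite !coef_sec.
have [m [j [-> j2]]] : exists m j, n = (2 * m + j)%N /\ (j < 2)%N.
  by exists (n %/ 2)%N, (n %% 2)%N; rewrite ltn_mod {1}(divn_eq n 2) mulnC.
have nd : (2 %| 2 * m + 1)%N = false by apply/negbTE/negP => /dvdnP [l]; lia.
case: j j2 => [|[|]]// _.
- rewrite addn0 dvdn_mulr// mulKn// addn0.
  case: m {nd} => [|m]; first by rewrite !addr0.
  have -> : (2 * m.+1 - 1 = 2 * m + 1)%N by lia.
  have -> : (2 %| 2 * m + 1)%N = false by apply/negbTE/negP => /dvdnP [l]; lia.
  by have := addr0; case: (2 * m.+1 < 1)%N => ->.
- have -> : (2 * m + 1 - 1 = 2 * m)%N by lia.
  by rewrite nd add0r ifF ?dvdn_mulr ?mulKn//; lia.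
Qed.

Lemma sec2M F G :
  sec 2 0 (F * G) = sec 2 0 F * sec 2 0 G + q * (sec 2 1 F * sec 2 1 G)
  /\ sec 2 1 (F * G) = sec 2 0 F * sec 2 1 G + sec 2 1 F * sec 2 0 G.
Proof.
have -> : F * G =
    dil 2 (sec 2 0 F * sec 2 0 G + q * (sec 2 1 F * sec 2 1 G))
    + q * dil 2 (sec 2 0 F * sec 2 1 G + sec 2 1 F * sec 2 0 G).
  rewrite {1}(dissect2 F) {1}(dissect2 G) !(rmorphD, rmorphM) /= dilq//.
  by ring.
exact: sec2_dissect.
Qed.

(* The product of F over the two substitutions of a square root of q. *)
Definition norm2 (F : fps) : fps := sec 2 0 F ^+ 2 - q * sec 2 1 F ^+ 2.

Lemma norm2M F G : norm2 (F * G) = norm2 F * norm2 G.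
Proof. by rewrite /norm2; have [-> ->] := sec2M F G; ring. Qed.

Lemma norm2_dissect (A B : fps) :
  norm2 (dil 2 A + q * dil 2 B) = A ^+ 2 - q * B ^+ 2.
Proof. by rewrite /norm2; have [-> ->] := sec2_dissect A B. Qed.

Lemma norm2_dil A : norm2 (dil 2 A) = A ^+ 2.
Proof.
by have := norm2_dissect A 0; rewrite rmorph0 mulr0 addr0 => ->; ring.
Qed.

Lemma norm2_1 : norm2 1 = 1.
Proof. by rewrite -(rmorph1 (dil 2)) norm2_dil expr1n rmorph1. Qed.

Lemma norm2X F k : norm2 (F ^+ k) = norm2 F ^+ k.
Proof.
by elim: k => [|k IH]; rewrite ?expr0 ?norm2_1// !exprS norm2M IH.
Qed.

Lemma norm2_prod (I : Type) (r : seq I) (P : pred I) (F : I -> fps) :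
  norm2 (\prod_(i <- r | P i) F i) = \prod_(i <- r | P i) norm2 (F i).
Proof. exact: (big_morph norm2 norm2M norm2_1). Qed.

Lemma norm2_eqmod M F G : eqmod (2 * M) F G -> eqmod M (norm2 F) (norm2 G).
Proof.
move=> h; have sh j : (j < 2)%N -> eqmod M (sec 2 j F ^+ 2) (sec 2 j G ^+ 2).
  by move=> j2; apply: eqmodX => i iM; rewrite !coef_sec h//; lia.
by apply: eqmodB; [apply: sh | apply: eqmodM => //; apply: sh].
Qed.

Lemma norm2_1Bqn m :
  norm2 (1 - q ^+ m) = if (2 %| m)%N then (1 - q ^+ (m %/ 2)) ^+ 2 else 1 - q ^+ m.
Proof.
have [k [j [-> j2]]] : exists k j, m = (2 * k + j)%N /\ (j < 2)%N.
  by exists (m %/ 2)%N, (m %% 2)%N; rewrite ltn_mod {1}(divn_eq m 2) mulnC.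
have qE : q ^+ (2 * k) = dil 2 (q ^+ k) by rewrite rmorphXn /= dilq// exprM.
case: j j2 => [|[|]]// _.
- rewrite addn0 dvdn_mulr// mulKn// qE.
  by rewrite -(rmorph1 (dil 2)) -rmorphB norm2_dil rmorph1.
- rewrite ifF; last by apply/negbTE/negP => /dvdnP [l]; lia.
  rewrite exprD qE expr1; have := norm2_dissect 1 (- q ^+ k).
  rewrite rmorph1 rmorphN /= mulrN (mulrC q) => ->.
  by rewrite -qE mulnC exprM; ring.
Qed.

(** The norm fixes the factors 1 - q^(kj) with j odd and turns j = 2i into (1 - q^(ki))^2, so the
    norm of f_k is (f_k/f_(2k)) f_k^2. *)
Lemma norm2_euler k : odd k -> norm2 (euler k) * euler (2 * k) = euler k ^+ 3.
Proof.
move=> ok; have k0 : (0 < k)%N by case: k ok.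
apply: eqmod_eq => M; apply: eqmod_sym.
pose T d N := \prod_(j < N) (1 - q ^+ (d * j.+1)).
have eT d N L : (0 < d)%N -> (L <= N)%N -> eqmod L (euler d) (T d N).
  by move=> d0 LN; apply: eulerE => //; lia.
have k20 : (0 < 2 * k)%N by lia.
have M2 : (M <= 2 * M)%N by lia.
apply: (@eqmod_trans _ _ (T k (2 * M)%N * T k M ^+ 2)).
  by rewrite exprS; apply: eqmodM; [|apply: eqmodX]; apply: eT.
apply: eqmod_sym; apply: (@eqmod_trans _ _ (norm2 (T k (2 * M)%N) * T (2 * k)%N M)).
  by apply: eqmodM; [apply: norm2_eqmod|]; apply: eT.
rewrite norm2_prod /T.
rewrite (prod_split (fun j => norm2 (1 - q ^+ (k * j.+1)))).
rewrite (prod_split (fun j => 1 - q ^+ (k * j.+1))).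
rewrite !big_ord_recr !big_ord0 /= !mul1r -prodrXl -!big_split /=.
rewrite (_ : \prod_(i < M) _ = \prod_(i < M) ((1 - q ^+ (k * (2 * i + 0).+1)) *
  (1 - q ^+ (k * (2 * i + 1).+1)) * (1 - q ^+ (k * i.+1)) ^+ 2))//.
apply: eq_bigr => j _.
rewrite (norm2_1Bqn (k * (2 * j + 0).+1)) ifF; last by rewrite dvdn2 oddM ok /=; lia.
have e2 : (k * (2 * j + 1).+1 = 2 * (k * j.+1))%N by lia.
by rewrite norm2_1Bqn e2 dvdn_mulr// mulKn// mulrAC mulnA.
Qed.

(** * Identities between theta functions and eta quotients *)

Lemma euler_neq0 k : (0 < k)%N -> euler k != 0.
Proof.
by move=> k0; apply/eqP => /(congr1 (fun F => coef F 0)); rewrite euler0// coef0.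
Qed.

Local Notation e1 := (euler 1).
Local Notation e2 := (euler 2).
Local Notation e3 := (euler 3).
Local Notation e6 := (euler 6).
Local Notation psi3 := (dil 3 psi).

(* Multiplies both sides of an equation by a nonzero u, usually the common denominator of the eta
   quotients involved. *)
Tactic Notation "cancel" constr(u) := apply: (@mulIf _ u); first by
  rewrite ?(mulf_neq0, expf_neq0, euler_neq0)//.

Lemma psi3_prod : psi3 * e3 = e6 ^+ 2.
Proof.
have := congr1 (dil 3) psi_prod.
by rewrite rmorphM rmorphXn /= !dil_euler.
Qed.

Lemma phim3_prod : dil 3 phim * e6 = e3 ^+ 2.
Proof.
have := congr1 (dil 3) phim_prod.
by rewrite rmorphM rmorphXn /= !dil_euler.
Qed.

Lemma pent_phim : pent * e1 = dil 3 phim * e2.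
Proof.
cancel e6; rewrite pent_prod -phim3_prod; ring.
Qed.

Lemma omega_psi : omega * e2 = psi3 * e1.
Proof.
cancel e3; rewrite omega_prod -psi3_prod; ring.
Qed.

(** Two evaluations of the norm of psi: the dissection gives P^3 + q Psi^3, while the quotient
    f_2^2/f_1 gives psi^4 f_3/f_6^2 = psi^4/Psi. *)
Lemma pent_psi_cube : psi3 * (pent ^+ 3 + q * psi3 ^+ 3) = psi ^+ 4.
Proof.
have d9 : dil 9 psi = dil 3 psi3 by rewrite dil_dil.
have N1 : norm3 psi = pent ^+ 3 + q * psi3 ^+ 3.
  have := norm3_dissect pent psi3 0.
  by rewrite rmorph0 mulr0 addr0 -d9 -psi_dissect3 => ->; ring.
rewrite -N1; have := congr1 norm3 psi_prod; rewrite norm3M norm3X => h.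
have h1 : norm3 e1 * e3 = e1 ^+ 4 := @norm3_euler 1 isT isT.
have h2 : norm3 e2 * e6 = e2 ^+ 4 := @norm3_euler 2 isT isT.
have key : norm3 psi * e1 ^+ 4 * e6 ^+ 2 = e2 ^+ 8 * e3.
  rewrite -h1 (_ : e2 ^+ 8 = (e2 ^+ 4) ^+ 2); last by ring.
  by rewrite -h2; ring: h.
cancel (e1 ^+ 4 * e6 ^+ 2 * e3).
have -> : psi3 * norm3 psi * (e1 ^+ 4 * e6 ^+ 2 * e3) =
  (psi3 * e3) * (norm3 psi * e1 ^+ 4 * e6 ^+ 2) by ring.
rewrite key psi3_prod (_ : psi ^+ 4 * _ = (psi * e1) ^+ 4 * (e6 ^+ 2 * e3)).
  by rewrite psi_prod; ring.
by ring.
Qed.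

(** Obtained from the dissection of psi by replacing q Psi(q^3) with -2 q Psi(q^3). The factor -2 is
    the one in the 3-dissection of phi(-q), which makes [chi] an eta quotient as well. *)
Definition chi : fps := dil 3 pent - 2%:R * q * dil 3 psi3.

(** P(q^3) and psi(q^9) are f_6/f_3 times phi(-q^9) and omega(q^3), so [chi] is (f_6/f_3)
    phi(-q). *)
Lemma chi_prod : chi * e2 * e3 = e1 ^+ 2 * e6.
Proof.
have h1 := congr1 (dil 3) pent_phim; have h2 := congr1 (dil 3) omega_psi.
rewrite !rmorphM /= !dil_euler ?dil_dil// in h1 h2.
rewrite /chi dil_dil// -phim_prod phim_dissect3.
have -> : (dil 3 pent - 2%:R * q * dil (3 * 3) psi) * e2 * e3 =
  (dil 3 pent * e3 - 2%:R * q * (dil (3 * 3) psi * e3)) * e2 by ring.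
by rewrite h1 -h2; ring.
Qed.

(** Two evaluations of the norm of [chi], from its dissection and from its eta quotient. *)
Lemma pent_psi_cube8 :
  (pent ^+ 3 - 8%:R * q * psi3 ^+ 3) * e2 * e3 ^+ 2 = e1 ^+ 5 * e6.
Proof.
have N1 : norm3 chi = pent ^+ 3 - 8%:R * q * psi3 ^+ 3.
  have := norm3_dissect pent (- 2%:R * psi3) 0.
  rewrite rmorph0 mulr0 addr0 rmorphM rmorphN rmorph_nat /=.
  rewrite (_ : dil 3 pent + _ = chi) => [->|]; last by rewrite /chi; ring.
  by ring.
rewrite -N1; have := congr1 norm3 chi_prod.
rewrite (norm3M (chi * e2)) (norm3M chi) (norm3M (e1 ^+ 2)) norm3X.
have -> : norm3 e3 = e1 ^+ 3 := @norm3_euler3 1 isT.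
have -> : norm3 e6 = e2 ^+ 3 := @norm3_euler3 2 isT => h.
have h1 : norm3 e1 * e3 = e1 ^+ 4 := @norm3_euler 1 isT isT.
have h2 : norm3 e2 * e6 = e2 ^+ 4 := @norm3_euler 2 isT isT.
cancel (e1 ^+ 3 * e2 ^+ 3).
have -> : norm3 chi * e2 * e3 ^+ 2 * (e1 ^+ 3 * e2 ^+ 3) =
  norm3 chi * e2 ^+ 4 * e1 ^+ 3 * e3 ^+ 2 by ring.
have -> : e1 ^+ 5 * e6 * (e1 ^+ 3 * e2 ^+ 3) = e1 ^+ 4 * e1 ^+ 4 * e2 ^+ 3 * e6 by ring.
by rewrite -h1 -h2; ring: h.
Qed.

Lemma theta1_0 t : t 0 = 0%N -> (forall k, `|k| <= t k)%N -> coef (theta1 t) 0 = 1.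
Proof.
by move=> t0 tb; rewrite /= /ibox big_cons big_nil /= subrr t0 eqxx addr0.
Qed.

Lemma psi0 : coef psi 0 = 1. Proof. exact: theta1_0 tpsi_ge. Qed.
Lemma pent0 : coef pent 0 = 1. Proof. exact: theta1_0 tpent_ge. Qed.
Lemma psi3_0 : coef psi3 0 = 1. Proof. by rewrite coef_dil psi0. Qed.

Lemma coef0_neq0 F : coef F 0 = 1 -> F != 0.
Proof. by move=> F0; apply/eqP => E; rewrite E coef0 in F0. Qed.

Lemma psi_neq0 : psi != 0. Proof. exact: coef0_neq0 psi0. Qed.
Lemma pent_neq0 : pent != 0. Proof. exact: coef0_neq0 pent0. Qed.
Lemma psi3_neq0 : psi3 != 0. Proof. exact: coef0_neq0 psi3_0. Qed.
Lemma psi9_neq0 : dil 3 psi3 != 0.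
Proof. by apply: coef0_neq0; rewrite coef_dil psi3_0. Qed.

(* The cubic theta functions a(q), b(q) and c(q)/(3 q^(1/3)) of the Borweins. *)
HB.lock Definition cub_a : fps := (psi ^+ 4 + 3%:R * q * psi3 ^+ 4) / (psi * psi3).
HB.lock Definition cub_b : fps := e1 ^+ 3 / e3.
HB.lock Definition cub_c : fps := e3 ^+ 3 / e1.

Local Notation a := cub_a.
Local Notation b := cub_b.
Local Notation c := cub_c.
Local Notation a2 := (dil 2 cub_a).
Local Notation b2 := (dil 2 cub_b).
Local Notation c2 := (dil 2 cub_c).

Tactic Notation "cancel" constr(u) := apply: (@mulIf _ u); first by
  rewrite ?(mulf_neq0, expf_neq0, euler_neq0, psi_neq0, psi3_neq0, psi9_neq0,
            pent_neq0)//.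

Lemma cub_aE : a * (psi * psi3) = psi ^+ 4 + 3%:R * q * psi3 ^+ 4.
Proof. by rewrite cub_a.unlock divrK// fps_unitP// coefM0 psi0 psi3_0. Qed.
Lemma cub_bE : b * e3 = e1 ^+ 3.
Proof. by rewrite cub_b.unlock divrK// euler_unit. Qed.
Lemma cub_cE : c * e1 = e3 ^+ 3.
Proof. by rewrite cub_c.unlock divrK// euler_unit. Qed.
Lemma cub_b2E : b2 * e6 = e2 ^+ 3.
Proof. by have := congr1 (dil 2) cub_bE; rewrite rmorphM rmorphXn /= !dil_euler. Qed.
Lemma cub_c2E : c2 * e2 = e6 ^+ 3.
Proof. by have := congr1 (dil 2) cub_cE; rewrite rmorphM rmorphXn /= !dil_euler. Qed.

Lemma cub_c_psi : c * psi = pent ^+ 2 * psi3.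
Proof.
cancel (e1 ^+ 2 * e6 ^+ 2 * e3).
have -> : c * psi * (e1 ^+ 2 * e6 ^+ 2 * e3) =
  (c * e1) * (psi * e1) * (e6 ^+ 2 * e3) by ring.
have -> : pent ^+ 2 * psi3 * (e1 ^+ 2 * e6 ^+ 2 * e3) =
  (pent * e1 * e6) ^+ 2 * (psi3 * e3) by ring.
by rewrite cub_cE psi_prod pent_prod psi3_prod; ring.
Qed.

Lemma pent_cub_c2 : pent * c2 = psi3 * c.
Proof.
cancel (e1 * e2 * e6 * e3).
have -> : pent * c2 * (e1 * e2 * e6 * e3) = (pent * e1 * e6) * (c2 * e2) * e3 by ring.
have -> : psi3 * c * (e1 * e2 * e6 * e3) = (psi3 * e3) * (c * e1) * (e2 * e6) by ring.
by rewrite pent_prod cub_c2E psi3_prod cub_cE; ring.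
Qed.

Lemma cub_c2_psi : c2 * psi = pent * psi3 ^+ 2.
Proof.
cancel pent; rewrite mulrAC (mulrC c2) pent_cub_c2 -mulrA cub_c_psi; ring.
Qed.

Lemma psi_split : psi = dil 3 pent + q * dil 3 psi3.
Proof. by rewrite dil_dil// -psi_dissect3. Qed.

Lemma psi3_quartic :
  psi3 ^+ 4 = dil 3 psi3 * (dil 3 pent ^+ 3 + q ^+ 3 * dil 3 psi3 ^+ 3).
Proof.
have := congr1 (dil 3) pent_psi_cube.
by rewrite !(rmorph_nat, rmorphXn, rmorphM, rmorphD) /= dilq// => ->.
Qed.

(** Substituting psi = p + q R and Y^4 = R (p^3 + q^3 R^3), with Y = psi(q^3), R = psi(q^9) and p =
    P(q^3), leaves a polynomial identity. *)
Ltac psi_ring :=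
  have := psi_split; have := psi3_quartic;
  move: (dil 3 psi3) (dil 3 pent) => R p; move: psi3 => Y; move: psi => Z -> ->;
  ring.

Lemma cub_a3E : dil 3 a * (psi3 * dil 3 psi3) =
  psi3 ^+ 4 + 3%:R * q ^+ 3 * dil 3 psi3 ^+ 4.
Proof.
have := congr1 (dil 3) cub_aE.
by rewrite !(rmorph_nat, rmorphXn, rmorphM, rmorphD) /= dilq.
Qed.

Lemma cub_c3E : dil 3 c * psi3 = dil 3 pent ^+ 2 * dil 3 psi3.
Proof.
by have := congr1 (dil 3) cub_c_psi; rewrite !(rmorph_nat, rmorphXn, rmorphM).
Qed.

Lemma cub_a_dissect3 : a = dil 3 a + 6%:R * q * dil 3 c.
Proof.
cancel (psi * psi3 * dil 3 psi3).
have -> : (dil 3 a + 6%:R * q * dil 3 c) * (psi * psi3 * dil 3 psi3) =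
  psi * (dil 3 a * (psi3 * dil 3 psi3)
         + 6%:R * q * (dil 3 c * psi3) * dil 3 psi3) by ring.
rewrite [LHS]mulrA cub_aE cub_a3E cub_c3E; psi_ring.
Qed.

Lemma cub_b_dissect3 : b = dil 3 a - 3%:R * q * dil 3 c.
Proof.
cancel (psi3 * dil 3 psi3).
have -> : (dil 3 a - 3%:R * q * dil 3 c) * (psi3 * dil 3 psi3) =
  dil 3 a * (psi3 * dil 3 psi3) - 3%:R * q * (dil 3 c * psi3) * dil 3 psi3 by ring.
(* This relation carries the eta quotient b over to the theta series on which [psi_ring] works. *)
have bchi : b * psi3 = psi * chi ^+ 2.
  cancel (e1 * e3 ^+ 2 * e2 ^+ 2).
  have -> : b * psi3 * (e1 * e3 ^+ 2 * e2 ^+ 2) =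
    (b * e3) * (psi3 * e3) * (e1 * e2 ^+ 2) by ring.
  have -> : psi * chi ^+ 2 * (e1 * e3 ^+ 2 * e2 ^+ 2) =
    (psi * e1) * (chi * e2 * e3) ^+ 2 by ring.
  by rewrite cub_bE psi3_prod psi_prod chi_prod; ring.
rewrite [LHS]mulrA bchi cub_a3E cub_c3E /chi; psi_ring.
Qed.

(** Descent on the exponent: a nonzero coefficient at n > 0 would force one at n/k. It yields
    uniqueness for equations of the form h = h(q^k) + g. *)
Lemma dil_fixed k F : (1 < k)%N -> F = dil k F -> coef F 0 = 0 -> F = 0.
Proof.
move=> k1 FE F0; apply: fpsP => n; rewrite coef0.
elim/ltn_ind: n => n IH; case: (posnP n) => [->//|n0].
rewrite FE coef_dil; case: ifP => // kn; apply: IH.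
by rewrite ltn_Pdiv.
Qed.

(* The quotient h on the right satisfies h(q) = h(q^3) + 6 q^2 c(q^6), the
   equation that the 3-dissection of a(q) gives for a(q^2). *)
Lemma cub_a2E : a2 * (psi * psi3) = psi ^+ 4 - 3%:R * q * psi3 ^+ 4.
Proof.
pose h : fps := (psi ^+ 4 - 3%:R * q * psi3 ^+ 4) / (psi * psi3).
have up : psi * psi3 \is a GRing.unit by rewrite fps_unitP// coefM0 psi0 psi3_0.
have hE : h * (psi * psi3) = psi ^+ 4 - 3%:R * q * psi3 ^+ 4 by rewrite divrK.
have h3E : dil 3 h * (psi3 * dil 3 psi3) =
    psi3 ^+ 4 - 3%:R * q ^+ 3 * dil 3 psi3 ^+ 4.
  have := congr1 (dil 3) hE.
  by rewrite !(rmorph_nat, rmorphXn, rmorphM, rmorphB) /= dilq.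
have c6E : dil 3 c2 * psi3 = dil 3 pent * dil 3 psi3 ^+ 2.
  by have := congr1 (dil 3) cub_c2_psi; rewrite !(rmorph_nat, rmorphXn, rmorphM).
have hrec : h = dil 3 h + 6%:R * q ^+ 2 * dil 3 c2.
  cancel (psi * psi3 * dil 3 psi3).
  have -> : (dil 3 h + 6%:R * q ^+ 2 * dil 3 c2) * (psi * psi3 * dil 3 psi3) =
    psi * (dil 3 h * (psi3 * dil 3 psi3)
         + 6%:R * q ^+ 2 * (dil 3 c2 * psi3) * dil 3 psi3) by ring.
  rewrite [LHS]mulrA hE h3E c6E; psi_ring.
have arec : a2 = dil 3 a2 + 6%:R * q ^+ 2 * dil 3 c2.
  rewrite {1}cub_a_dissect3 !(rmorph_nat, rmorphM, rmorphD) /= dilq//.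
  by rewrite !dil_dil.
have h0 : coef h 0 = 1.
  have := congr1 (fun F => coef F 0) hE.
  by rewrite !coefM0 psi0 psi3_0 coefB !exprS !expr0 !coefM0 psi0 psi3_0 /= !mulr1.
have a0 : coef a2 0 = 1.
  rewrite coef_dil /=; have := congr1 (fun F => coef F 0) cub_aE.
  by rewrite !coefM0 psi0 psi3_0 coefD !exprS !expr0 !coefM0 psi0 psi3_0 /= !mulr1.
suff : a2 - h = 0 by move/subr0_eq ->.
apply: (@dil_fixed 3) => //; last by rewrite coefB a0 h0.
by rewrite rmorphB {1}arec {1}hrec; ring.
Qed.

(** After multiplication by psi this is a linear consequence of psi^4 = Psi (P^3 + q Psi^3). *)
Lemma cub_a2_pent : 3%:R * c * pent - a * psi3 = 2%:R * psi3 * a2.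
Proof.
cancel psi.
have -> : (3%:R * c * pent - a * psi3) * psi =
  3%:R * pent * (c * psi) - a * (psi * psi3) by ring.
have -> : 2%:R * psi3 * a2 * psi = 2%:R * (a2 * (psi * psi3)) by ring.
by rewrite cub_c_psi cub_aE cub_a2E -pent_psi_cube; ring.
Qed.

Lemma cub_a_pent : a * pent = a2 * pent + 6%:R * q * psi3 * c2.
Proof.
cancel (psi * psi3).
have -> : a * pent * (psi * psi3) = pent * (a * (psi * psi3)) by ring.
have -> : (a2 * pent + 6%:R * q * psi3 * c2) * (psi * psi3) =
  pent * (a2 * (psi * psi3)) + 6%:R * q * psi3 ^+ 2 * (c2 * psi) by ring.
by rewrite cub_c2_psi cub_aE cub_a2E; ring.
Qed.

(** The two preceding lemmas say a - a(q^2) = 6 q Psi c(q^2)/P and a + 2 a(q^2) = 3 c P/Psi; these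
    are multiplied. *)
Lemma cub_a_c : (a - a2) * (a + 2%:R * a2) = 18%:R * q * c * c2.
Proof.
cancel (psi3 * pent).
have -> : (a - a2) * (a + 2%:R * a2) * (psi3 * pent) =
  (a * pent - a2 * pent) * (a * psi3 + 2%:R * psi3 * a2) by ring.
by rewrite cub_a_pent -cub_a2_pent; ring.
Qed.

(** The eta quotient b b(q^2) equals psi^2/Psi times P^3 - 8 q Psi^3; the rest is polynomial in psi,
    Psi and P modulo the quartic relation. *)
Lemma cub_b_c : b * b2 = a * a2 - 9%:R * q * c * c2.
Proof.
cancel ((psi * psi3) ^+ 2).
have -> : (a * a2 - 9%:R * q * c * c2) * (psi * psi3) ^+ 2 =
  (a * (psi * psi3)) * (a2 * (psi * psi3))
  - 9%:R * q * (c * psi) * (c2 * psi) * psi3 ^+ 2 by ring.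
rewrite cub_aE cub_a2E cub_c_psi cub_c2_psi.
have bb : b * b2 * psi3 = psi ^+ 2 * (pent ^+ 3 - 8%:R * q * psi3 ^+ 3).
  cancel (e3 ^+ 2 * e6 * e1 ^+ 2 * e2).
  have -> : b * b2 * psi3 * (e3 ^+ 2 * e6 * e1 ^+ 2 * e2) =
    (b * e3) * (b2 * e6) * (psi3 * e3) * (e1 ^+ 2 * e2) by ring.
  have -> : psi ^+ 2 * (pent ^+ 3 - 8%:R * q * psi3 ^+ 3) *
    (e3 ^+ 2 * e6 * e1 ^+ 2 * e2) = (psi * e1) ^+ 2 *
    ((pent ^+ 3 - 8%:R * q * psi3 ^+ 3) * e2 * e3 ^+ 2) * e6 by ring.
  by rewrite cub_bE cub_b2E psi3_prod psi_prod pent_psi_cube8; ring.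
rewrite -pent_psi_cube.
have -> : b * b2 * (psi * psi3) ^+ 2 = (b * b2 * psi3) * (psi ^+ 2 * psi3) by ring.
rewrite bb (_ : psi ^+ 2 * _ * _ = psi ^+ 4 * (pent ^+ 3 - 8%:R * q * psi3 ^+ 3) * psi3).
  by rewrite -pent_psi_cube; ring.
by ring.
Qed.

(** * The 2-dissection of c *)

(** At q^2 the left side is phi(q) phi(-q), a difference of two squares by the 2-dissection of
    phi. *)
Lemma phim_sqr : phim ^+ 2 = dil 2 phi ^+ 2 - 4%:R * q * dil 4 psi ^+ 2.
Proof.
apply: (@dil_inj 2) => //.
rewrite rmorphXn /= -phi_phim [in LHS]phi_dissect2 [in LHS]phim_dissect2.
rewrite !(rmorph_nat, rmorphXn, rmorphM, rmorphB) /= dilq// !dil_dil//; ring.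
Qed.

Lemma phi_phi3 :
  phi * dil 3 phi - phim * dil 3 phim = 4%:R * q * dil 2 psi * dil 6 psi.
Proof.
have L := congr1 (dil 2) psi_psi3.
rewrite !(rmorph_nat, rmorphM, rmorphD) /= dilq// !dil_dil// in L.
have -> : 4%:R * q * dil 2 psi * dil 6 psi = 4%:R * q * (dil 2 psi * dil 6 psi).
  by ring.
rewrite L [in LHS]phi_dissect2 [in LHS]phim_dissect2.
rewrite !(rmorph_nat, rmorphM, rmorphB, rmorphD) /= dilq// !dil_dil//; ring.
Qed.

(** Multiplying c by the even series f_2^2 gives psi Psi phi(-q^3)^2, whose 2-dissection is known.
    H(q^2) is its even part; in the odd part the bracket that remains is phi(-q^2) phi(-q^6), which
    makes it q f_2^2 c(q^4). The even part of c is so far only known as H/f_1^2 at q^2. *)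
Lemma cub_c_even_odd : exists2 h, coef h 0 = 1 & c = dil 2 h + q * dil 4 c.
Proof.
pose H := dil 3 phi ^+ 3 * dil 2 psi - 4%:R * q ^+ 2 * phi * dil 6 psi ^+ 3.
have cE : c * e2 ^+ 2 = psi * psi3 * dil 3 phim ^+ 2.
  cancel (e1 * e3 * e6 ^+ 2).
  have -> : c * e2 ^+ 2 * (e1 * e3 * e6 ^+ 2) =
    (c * e1) * (e2 ^+ 2 * e3 * e6 ^+ 2) by ring.
  have -> : psi * psi3 * dil 3 phim ^+ 2 * (e1 * e3 * e6 ^+ 2) =
    (psi * e1) * (psi3 * e3) * (dil 3 phim * e6) ^+ 2 by ring.
  by rewrite cub_cE psi_prod psi3_prod phim3_prod; ring.
have phim3_sqr : dil 3 phim ^+ 2 = dil 6 phi ^+ 2 - 4%:R * q ^+ 3 * dil 12 psi ^+ 2.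
  rewrite -rmorphXn phim_sqr !(rmorph_nat, rmorphXn, rmorphM, rmorphB) /= dilq//.
  by rewrite !dil_dil.
have odd_part : dil 3 phi * dil 6 psi * (phim * dil 3 phim) = c2 * e1 ^+ 2.
  have e12 : dil 6 phim * euler 12 = e6 ^+ 2.
    have := congr1 (dil 2) phim3_prod.
    by rewrite rmorphM rmorphXn /= !dil_euler// dil_dil.
  have p12 : dil 6 psi * e6 = euler 12 ^+ 2.
    have := congr1 (dil 2) psi3_prod.
    by rewrite rmorphM rmorphXn /= !dil_euler// dil_dil.
  have pp : dil 3 phi * dil 3 phim = dil 6 phim ^+ 2.
    have := congr1 (dil 3) phi_phim.
    by rewrite rmorphM rmorphXn /= dil_dil.
  cancel (e2 * euler 12 ^+ 2 * e6).
  have -> : dil 3 phi * dil 6 psi * (phim * dil 3 phim) * (e2 * euler 12 ^+ 2 * e6)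
    = (dil 3 phi * dil 3 phim) * euler 12 ^+ 2 * (dil 6 psi * e6) * (phim * e2).
    by ring.
  rewrite pp -exprMn e12 p12 phim_prod.
  rewrite (_ : c2 * _ * _ = (c2 * e2) * (e1 ^+ 2 * euler 12 ^+ 2 * e6)).
    by rewrite cub_c2E; ring.
  by ring.
have u1 : e1 ^+ 2 \is a GRing.unit by rewrite unitrX// euler_unit.
exists (H / e1 ^+ 2).
  have := congr1 (fun F => coef F 0) (divrK u1 H).
  rewrite coefM0 exprS expr1 !coefM0 euler0// !mulr1 => ->.
  have p0 : coef phi 0 = 1 by exact: theta1_0 tsq_ge.
  by rewrite coefB !exprS !expr0 !coefM0 !coef_dil p0 psi0.
have He : dil 2 (H / e1 ^+ 2) * e2 ^+ 2 = dil 2 H.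
  have -> : e2 ^+ 2 = dil 2 (e1 ^+ 2) by rewrite rmorphXn /= dil_euler.
  by rewrite -rmorphM divrK.
have Ke : dil 4 c * e2 ^+ 2 =
    dil 6 phi * dil 12 psi * (dil 2 phim * dil 6 phim).
  have := congr1 (dil 2) odd_part.
  by rewrite !(rmorphXn, rmorphM) /= dil_euler// !dil_dil.
have PP : dil 2 phim * dil 6 phim =
    dil 2 phi * dil 6 phi - 4%:R * q ^+ 2 * dil 4 psi * dil 12 psi.
  have := congr1 (dil 2) phi_phi3.
  rewrite !(rmorph_nat, rmorphM, rmorphB) /= dilq// !dil_dil// => E.
  by rewrite -[LHS]opprK -E; ring.
cancel (e2 ^+ 2).
rewrite cE psi_psi3 phim3_sqr [RHS]mulrDl He -[q * _ * _]mulrA Ke PP /H.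
by rewrite !(rmorph_nat, rmorphXn, rmorphM, rmorphB) /= dilq// !dil_dil//; ring.
Qed.

(** The norm of c is h^2 - q c(q^2)^2 and also an explicit eta quotient, so h^2 is known; the
    quartic relation for psi turns it into (psi P)^2. *)
Lemma cub_c_dissect2 : c = dil 2 (psi * pent) + q * dil 4 c.
Proof.
have [h h0 cE] := cub_c_even_odd; rewrite {1}cE; congr (dil 2 _ + _).
have N : h ^+ 2 - q * c2 ^+ 2 = norm2 c.
  by rewrite {2}cE -[dil 4 c](@dil_dil 2 2 c)// norm2_dissect.
have n1 : norm2 e1 * e2 = e1 ^+ 3 := @norm2_euler 1 isT.
have n3 : norm2 e3 * e6 = e3 ^+ 3 := @norm2_euler 3 isT.
have Nc : norm2 c * (e1 ^+ 3 * e6 ^+ 3) = e3 ^+ 9 * e2.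
  have := congr1 norm2 cub_cE; rewrite norm2M norm2X => E.
  rewrite -n1 (_ : e3 ^+ 9 = (e3 ^+ 3) ^+ 3); last by ring.
  by rewrite -n3; ring: E.
have P : psi3 * pent ^+ 3 * (e1 ^+ 4 * e3 ^+ 4 * e6) = e1 * e2 ^+ 3 * e3 ^+ 9.
  cancel (e6 ^+ 2).
  have -> : psi3 * pent ^+ 3 * (e1 ^+ 4 * e3 ^+ 4 * e6) * e6 ^+ 2 =
    (psi3 * e3) * (pent * e1 * e6) ^+ 3 * (e1 * e3 ^+ 3) by ring.
  by rewrite psi3_prod pent_prod; ring.
(* The relation psi^4 = Psi (P^3 + q Psi^3) in terms of Euler products. *)
have E2 : e2 ^+ 8 * e3 ^+ 4 * e6 =
    e1 * e2 ^+ 3 * e3 ^+ 9 + q * e6 ^+ 9 * e1 ^+ 4.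
  have -> : e2 ^+ 8 = (psi * e1) ^+ 4 by rewrite psi_prod; ring.
  rewrite exprMn -pent_psi_cube -P.
  have -> : q * e6 ^+ 9 * e1 ^+ 4 = q * (psi3 * e3) ^+ 4 * e1 ^+ 4 * e6.
    by rewrite psi3_prod; ring.
  by ring.
have sq : h ^+ 2 = (psi * pent) ^+ 2.
  have -> : h ^+ 2 = norm2 c + q * c2 ^+ 2 by rewrite -N subrK.
  cancel (e1 ^+ 4 * e6 ^+ 3 * e2 ^+ 2).
  have -> : (norm2 c + q * c2 ^+ 2) * (e1 ^+ 4 * e6 ^+ 3 * e2 ^+ 2) =
    norm2 c * (e1 ^+ 3 * e6 ^+ 3) * (e1 * e2 ^+ 2)
    + q * (c2 * e2) ^+ 2 * (e1 ^+ 4 * e6 ^+ 3) by ring.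
  have -> : (psi * pent) ^+ 2 * (e1 ^+ 4 * e6 ^+ 3 * e2 ^+ 2) =
    (psi * e1) ^+ 2 * (pent * e1 * e6) ^+ 2 * (e6 * e2 ^+ 2) by ring.
  rewrite Nc cub_c2E psi_prod pent_prod.
  have -> : (e2 ^+ 2) ^+ 2 * (e2 * e3 ^+ 2) ^+ 2 * (e6 * e2 ^+ 2) =
    e2 ^+ 8 * e3 ^+ 4 * e6 by ring.
  by rewrite E2; ring.
(* The alternative h = - psi P is excluded by the constant terms, both equal to 1. *)
apply/eqP; rewrite -subr_eq0; have /eqP := sq.
rewrite -subr_eq0 subr_sqr mulf_eq0 => /orP[//|/eqP E].
have := congr1 (fun F => coef F 0) E.
by rewrite coefD coefM0 h0 psi0 pent0 coef0.
Qed.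

(** * Sums of four squares *)

Definition sum4sq (n : int) : Prop :=
  exists x y z w : int, n = x * x + y * y + z * z + w * w.

(** Euler's four square identity. *)
Lemma sum4sqM m n : sum4sq m -> sum4sq n -> sum4sq (m * n).
Proof.
move=> [x1 [x2 [x3 [x4 ->]]]] [y1 [y2 [y3 [y4 ->]]]].
exists (x1 * y1 + x2 * y2 + x3 * y3 + x4 * y4), (x1 * y2 - x2 * y1 + x3 * y4 - x4 * y3).
exists (x1 * y3 - x3 * y1 + x4 * y2 - x2 * y4), (x1 * y4 - x4 * y1 + x2 * y3 - x3 * y2).
by ring.
Qed.

(** Since the sum is even, the four roots pair off by parity, and (x^2 + y^2)/2 = ((x+y)/2)^2 +
    ((x-y)/2)^2 for each pair. *)
Lemma sum4sq_half n : sum4sq (2 * n) -> sum4sq n.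
Proof.
have main x y z w : 2 * n = x * x + y * y + z * z + w * w ->
    ((x - y) %% 2)%Z = 0 -> ((z - w) %% 2)%Z = 0 -> sum4sq n.
  move=> nE xy zw.
  have [s xE] : exists s, x = y + 2 * s by exists (divz (x - y) 2); lia.
  have [t zE] : exists t, z = w + 2 * t by exists (divz (z - w) 2); lia.
  exists (y + s), s, (w + t), t; rewrite xE zE in nE; lia.
move=> [x [y [z [w nE]]]].
have par (v : int) : exists u, v * v = v + 2 * u.
  have [s [->|->]] : exists s : int, v = 2 * s \/ v = 2 * s + 1.
    by exists (divz v 2); lia.
  - by exists (2 * s * s - s); ring.
  - by exists (2 * s * s + s); ring.
have [x' xE] := par x; have [y' yE] := par y.
have [z' zE] := par z; have [w' wE] := par w.
have hs : ((x + y + z + w) %% 2)%Z = 0 by lia.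
have [[h h']|[[h h']|[h h']]] :
    ((x - y) %% 2)%Z = 0 /\ ((z - w) %% 2)%Z = 0 \/
    ((x - z) %% 2)%Z = 0 /\ ((y - w) %% 2)%Z = 0 \/
    ((x - w) %% 2)%Z = 0 /\ ((y - z) %% 2)%Z = 0.
  clear - hs; lia.
- exact: (main x y z w).
- by apply: (main x z y w) => //; rewrite nE; ring.
- by apply: (main x w y z) => //; rewrite nE; ring.
Qed.

Lemma balanced_residue (m : nat) (x : int) : odd m ->
  exists t y : int, x = m%:Z * t + y /\ (2 * absz y < m)%N.
Proof.
move=> om; have m0 : 0 < m%:Z by case: m om.
have := divz_eq x m%:Z; have := ltz_pmod x m0; have := modz_ge0 x (lt0r_neq0 m0).
move: (divz x m%:Z) (modz x m%:Z) => t y y0 ym xE.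
case: (ltnP (2 * absz y) m) => h; first by exists t, y; split => //; rewrite xE; ring.
by exists (t + 1), (y - m%:Z); split; [rewrite xE; ring | lia].
Qed.

Lemma sqr_lt_half (m : nat) (y : int) : (2 * absz y < m)%N ->
  0 <= y * y /\ 4 * (y * y) < m%:Z * m%:Z.
Proof.
move=> ym; split; first by rewrite -expr2 sqr_ge0.
have h1 : 0 < m%:Z - 2 * y by lia.
have h2 : 0 < m%:Z + 2 * y by lia.
by have := mulr_gt0 h1 h2; lia.
Qed.

(** Lagrange's descent on m. An even m is halved; for odd m > 1 the roots x_i are reduced to y_i
    with 2|y_i| < m. Then the y_i^2 sum to m r with r < m, and Euler's identity divided by m^2
    represents r p. *)
Lemma sum4sq_descent (p m : nat) : prime p -> (0 < m < p)%N ->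
  sum4sq (m%:Z * p%:Z) -> sum4sq p%:Z.
Proof.
move=> pp; elim/ltn_ind: m => m IH /andP[m0 mp] h.
case: (ltngtP m 1) => m1; [lia | | by rewrite m1 mul1r in h].
case: (boolP (odd m)) => om; last first.
  have mE : m = (2 * m./2)%N by lia.
  apply: (IH m./2); [lia | lia |].
  by apply: sum4sq_half; rewrite mulrA -PoszM -mE.
have [x1 [x2 [x3 [x4 xE]]]] := h.
have [t1 [y1 [E1 l1]]] := balanced_residue x1 om.
have [t2 [y2 [E2 l2]]] := balanced_residue x2 om.
have [t3 [y3 [E3 l3]]] := balanced_residue x3 om.
have [t4 [y4 [E4 l4]]] := balanced_residue x4 om.
pose T := t1 * t1 + t2 * t2 + t3 * t3 + t4 * t4.
pose S := t1 * y1 + t2 * y2 + t3 * y3 + t4 * y4.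
pose r := p%:Z - m%:Z * T - 2 * S.
have YE : y1 * y1 + y2 * y2 + y3 * y3 + y4 * y4 = m%:Z * r.
  rewrite E1 E2 E3 E4 in xE.
  by rewrite /r 2!mulrBr xE /T /S; ring.
have [q1 Q1] := sqr_lt_half l1; have [q2 Q2] := sqr_lt_half l2.
have [q3 Q3] := sqr_lt_half l3; have [q4 Q4] := sqr_lt_half l4.
have mz : 0 < m%:Z by rewrite ltz_nat.
have r0 : 0 <= r by rewrite -(pmulr_rge0 _ mz) -YE !addr_ge0.
have rm : r < m%:Z.
  rewrite -(ltr_pM2l mz) -YE; clear - Q1 Q2 Q3 Q4; lia.
(* If r = 0, all y_i vanish, so m divides p, impossible for 1 < m < p. *)
have [rE|rn0] := eqVneq r 0.
  have z1 : y1 * y1 = 0 by rewrite rE in YE; lia.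
  have z2 : y2 * y2 = 0 by rewrite rE in YE; lia.
  have z3 : y3 * y3 = 0 by rewrite rE in YE; lia.
  have z4 : y4 * y4 = 0 by rewrite rE in YE; lia.
  have z (y : int) : y * y = 0 -> y = 0 by move/eqP; rewrite mulf_eq0 orbb => /eqP.
  have S0 : S = 0 by rewrite /S (z _ z1) (z _ z2) (z _ z3) (z _ z4); ring.
  have pE : p%:Z = m%:Z * T by move: rE; rewrite /r S0; lia.
  have /(prime_nt_dvdP pp) : (m %| p)%N.
    by apply/dvdnP; exists (absz T); have := congr1 absz pE; rewrite abszM /= mulnC.
  by move=> /(_ _) E; have := E (negbT (gtn_eqF m1)); lia.
have [k kE] : exists k : nat, r = k%:Z by exists (absz r); lia.
apply: (IH k); [lia | lia |].
(* The coordinates of Euler's identity for x and y, divided by m after substituting x_i = m t_i +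
   y_i. *)
exists (S + r), (t1 * y2 - t2 * y1 + t3 * y4 - t4 * y3).
exists (t1 * y3 - t3 * y1 + t4 * y2 - t2 * y4), (t1 * y4 - t4 * y1 + t2 * y3 - t3 * y2).
have pE : p%:Z = r + m%:Z * T + 2 * S by rewrite /r; ring.
rewrite -kE pE.
have -> : r * (r + m%:Z * T + 2 * S) = r * r + (m%:Z * r) * T + 2 * S * r by ring.
by rewrite -YE /T /S; ring.
Qed.

(** Pigeonhole: the residues of i^2 and of -1 - j^2, for i, j from 0 to (p-1)/2, form two families
    of (p+1)/2 distinct classes each, so they meet. *)
Lemma prime_sum3sq (p : nat) : prime p -> odd p ->
  exists x y m : nat, (0 < m < p)%N /\ (x * x + y * y + 1 = m * p)%N.
Proof.
move=> pp op; set h := p./2.+1.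
have p0 := prime_gt0 pp; have p1 := prime_gt1 pp.
pose f (i : 'I_h) : 'I_p := Ordinal (ltn_pmod (i * i) p0).
(* Adding p^2 keeps -1 - i^2 natural without changing its class. *)
pose g (i : 'I_h) : 'I_p := Ordinal (ltn_pmod (p * p - 1 - i * i) p0).
have iP (i : 'I_h) : (2 * i < p)%N by have := ltn_ord i; rewrite /h; lia.
have key (i j : 'I_h) : (i <= j)%N -> (p %| j * j - i * i)%N -> i = j.
  move=> ij; have -> : (j * j - i * i = (j - i) * (j + i))%N by nia.
  have hi := iP i; have hj := iP j.
  rewrite Euclid_dvdM// => /orP[] /dvdnP [k kE]; apply: val_inj => /=.
    by case: k kE => [|k] kE; nia.
  by case: k kE => [|k] kE; nia.
have f_inj : injective f.
  move=> i j /(congr1 val) /= /eqP E.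
  case: (leqP i j) => ij.
    by apply: key => //; rewrite -eqn_mod_dvd ?(eqP E)//; nia.
  by apply/esym/key; rewrite ?(ltnW ij)// -eqn_mod_dvd//; nia.
have g_inj : injective g.
  move=> i j /(congr1 val) /= /eqP E; have hi := iP i; have hj := iP j.
  case: (leqP i j) => ij.
    apply: key => //.
    have -> : (j * j - i * i = (p * p - 1 - i * i) - (p * p - 1 - j * j))%N by nia.
    by rewrite -eqn_mod_dvd//; nia.
  apply/esym/key; first exact: ltnW.
  have -> : (i * i - j * j = (p * p - 1 - j * j) - (p * p - 1 - i * i))%N by nia.
  by rewrite -eqn_mod_dvd//; [rewrite eq_sym | nia].
have [i [j ij]] : exists i j, f i = g j.
  apply: contrapT => no.
  have dis : [disjoint [set f i | i in 'I_h] & [set g i | i in 'I_h]].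
    apply/pred0P => z /=; apply/negbTE/negP => /andP[/imsetP[i _ ->] /imsetP[j _ E]].
    by apply: no; exists i, j.
  have := max_card (mem ([set f i | i in 'I_h] :|: [set g i | i in 'I_h])).
  have -> : #|[set f i | i in 'I_h] :|: [set g i | i in 'I_h]| = (h + h)%N.
    move: dis; rewrite -setI_eq0 cardsU => /eqP ->; rewrite cards0 subn0.
    by rewrite !card_imset// card_ord.
  by rewrite// !card_ord /h; lia.
have hi := iP i; have hj := iP j.
have /dvdnP [m mE] : (p %| i * i + j * j + 1)%N.
  have := congr1 val ij => /= /eqP E.
  have : (i * i + (j * j + 1) == (p * p - 1 - j * j) + (j * j + 1) %[mod p])%N.
    by rewrite eqn_modDr.
  rewrite (_ : (p * p - 1 - j * j) + (j * j + 1) = p * p)%N; last by nia.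
  by rewrite modnMl addnA.
exists i, j, m; split => //.
have : (4 * (m * p) < 4 * (p * p))%N by nia.
by case: m mE => [|m] mE; [lia | rewrite !mulnA ltn_mul2r; nia].
Qed.

Theorem lagrange_four_squares (n : nat) : sum4sq n%:Z.
Proof.
elim/ltn_ind: n => n IH.
case: (leqP n 1) => n1; first by exists n%:Z, 0, 0, 0; case: n n1 {IH} => [|[|]].
have pp := pdiv_prime n1; set p := pdiv n in pp.
have [k kE] : exists k, n = (k * p)%N by apply/dvdnP/pdiv_dvd.
have sp : sum4sq p%:Z.
  case: (boolP (odd p)) => op; last first.
    have -> : p = 2 by case: (even_prime pp) op => // ->.
    by exists 1, 1, 0, 0.
  have [x [y [m [mp E]]]] := prime_sum3sq pp op.
  apply: (sum4sq_descent pp mp); exists x%:Z, y%:Z, 1, 0.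
  by rewrite -PoszM -E; lia.
rewrite kE PoszM; apply: sum4sqM => //; apply: IH.
by have := prime_gt1 pp; nia.
Qed.

(** If 3 divides x + y + z and x, y have equal parity, then s = (x+y+z)/3, t = (x-y)/2 and u =
    (s-z)/2 satisfy x^2 + y^2 + z^2 = 3s^2 + 2t^2 + 6u^2. Two of three integers always agree in
    parity, so only a choice of three of Lagrange's four roots, with signs, whose sum is divisible
    by 3 is needed. *)
Lemma sum_1236 (n : nat) : exists d s t u : int,
  n%:Z = d * d + 3 * (s * s) + 2 * (t * t + 3 * (u * u)).
Proof.
have fin2 (d x y z : int) : n%:Z = d * d + x * x + y * y + z * z ->
    ((x + y + z) %% 3)%Z = 0 -> ((x - y) %% 2)%Z = 0 ->
    exists d s t u : int, n%:Z = d * d + 3 * (s * s) + 2 * (t * t + 3 * (u * u)).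
  move=> nE h3 h2.
  have [s sE] : exists s, x + y + z = 3 * s by exists (divz (x + y + z) 3); lia.
  have [t tE] : exists t, x - y = 2 * t by exists (divz (x - y) 2); lia.
  have [u uE] : exists u, s - z = 2 * u by exists (divz (s - z) 2); lia.
  have zE : z = s - 2 * u by lia.
  have yE : y = s + u - t by lia.
  have xE : x = s + u + t by lia.
  by exists d, s, t, u; rewrite nE xE yE zE; ring.
have fin3 (d x y z : int) : n%:Z = d * d + x * x + y * y + z * z ->
    ((x + y + z) %% 3)%Z = 0 ->
    exists d s t u : int, n%:Z = d * d + 3 * (s * s) + 2 * (t * t + 3 * (u * u)).
  move=> nE h3.
  have [h|[h|h]] : ((x - y) %% 2)%Z = 0 \/ ((x - z) %% 2)%Z = 0 \/ ((y - z) %% 2)%Z = 0.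
    by lia.
  - exact: (fin2 d x y z).
  - by apply: (fin2 d x z y) => //; [rewrite nE; ring | lia].
  - by apply: (fin2 d y z x) => //; [rewrite nE; ring | lia].
have [x [y [z [w nE]]]] := lagrange_four_squares n.
have sgn (v : int) : exists v', v' * v' = v * v /\ ((v' %% 3)%Z = 0 \/ (v' %% 3)%Z = 1).
  case: (eqVneq (v %% 3)%Z 2) => h; last by exists v; split => //; lia.
  by exists (- v); split; [ring | lia].
have [x' [xx hx]] := sgn x; have [y' [yy hy]] := sgn y.
have [z' [zz hz]] := sgn z; have [w' [ww hw]] := sgn w.
rewrite -xx -yy -zz -ww in nE.
(* All residues are now 0 or 1. Either three of them agree, or exactly two are 1; then one of these
   is negated and both are joined with a root divisible by 3. *)
have [h|[h|[h|[h|[h|[h|[h|[h|[h|h]]]]]]]]] :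
  ((x' + y' + z') %% 3)%Z = 0 \/ ((x' + y' + w') %% 3)%Z = 0 \/
  ((x' + z' + w') %% 3)%Z = 0 \/ ((y' + z' + w') %% 3)%Z = 0 \/
  ((x' + - y' + z') %% 3)%Z = 0 \/ ((x' + - z' + y') %% 3)%Z = 0 \/
  ((x' + - w' + y') %% 3)%Z = 0 \/ ((y' + - z' + x') %% 3)%Z = 0 \/
  ((y' + - w' + x') %% 3)%Z = 0 \/ ((z' + - w' + x') %% 3)%Z = 0 by lia.
all: apply: (fin3 _ _ _ _ _ h); rewrite nE.
- by instantiate (1 := w'); ring.
- by instantiate (1 := z'); ring.
- by instantiate (1 := y'); ring.
- by instantiate (1 := x'); ring.
- by instantiate (1 := w'); ring.
- by instantiate (1 := w'); ring.
- by instantiate (1 := z'); ring.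
- by instantiate (1 := w'); ring.
- by instantiate (1 := z'); ring.
- by instantiate (1 := y'); ring.
Qed.

(** * Positivity *)

Definition nonneg (F : fps) : Prop := forall n, 0 <= coef F n.

Lemma nonnegD F G : nonneg F -> nonneg G -> nonneg (F + G).
Proof. by move=> hF hG n; rewrite coefD addr_ge0. Qed.
Lemma nonnegM F G : nonneg F -> nonneg G -> nonneg (F * G).
Proof. by move=> hF hG n; rewrite coefM sumr_ge0// => i _; rewrite mulr_ge0. Qed.
Lemma nonneg_dil k F : nonneg F -> nonneg (dil k F).
Proof. by move=> hF n; rewrite coef_dil; case: ifP. Qed.
Lemma nonneg_nat m : nonneg m%:R.
Proof. by move=> n; rewrite coef_nat; case: ifP; rewrite // ler0n. Qed.
Lemma nonnegq : nonneg q. Proof. by case=> [|[|]]. Qed.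
Lemma nonneg_theta1 t : nonneg (theta1 t).
Proof. by move=> n; apply: sumr_ge0. Qed.
Lemma nonnegX F k : nonneg F -> nonneg (F ^+ k).
Proof.
move=> hF; elim: k => [|k IH]; last by rewrite exprS; apply: nonnegM.
exact: (nonneg_nat 1).
Qed.

Lemma coefM_gt0 F G i j : nonneg F -> nonneg G ->
  0 < coef F i -> 0 < coef G j -> 0 < coef (F * G) (i + j).
Proof.
move=> hF hG Fi Gj; have ilt : (i < (i + j).+1)%N by lia.
rewrite coefM (bigD1 (Ordinal ilt)) //= addKn ltr_pwDl ?mulr_gt0//.
by apply: sumr_ge0 => k _; rewrite mulr_ge0.
Qed.

Lemma coefM_gt0r F G n : nonneg F -> nonneg G ->
  0 < coef F n -> coef G 0 = 1 -> 0 < coef (F * G) n.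
Proof. by move=> hF hG Fn G0; rewrite -(addn0 n) coefM_gt0 ?G0. Qed.

Lemma theta1_gt0 t k : (forall k, `|k| <= t k)%N -> 0 < coef (theta1 t) (t k).
Proof.
move=> tb; have kin : k \in ibox (t k) by rewrite mem_ibox tb.
by rewrite /= (big_rem k kin) /= eqxx ltr_pwDl// sumr_ge0.
Qed.

Lemma nonneg_c : nonneg c.
Proof.
elim/ltn_ind => n IH; rewrite cub_c_dissect2 coefD addr_ge0//.
  by apply/nonneg_dil/nonnegM; apply: nonneg_theta1.
rewrite coefqM; case: n IH => // n IH; rewrite coef_dil; case: ifP => // _.
by apply: IH; rewrite ltnS leq_div.
Qed.

Lemma a0 : coef a 0 = 1.
Proof.
have := congr1 (fun F => coef F 0) cub_aE.
by rewrite !coefM0 psi0 psi3_0 coefD !exprS !expr0 !coefM0 psi0 psi3_0 /= !mulr1.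
Qed.

Lemma nonneg_qc3 m : nonneg (m%:R * q * dil 3 c).
Proof.
by apply: nonnegM; [apply: nonnegM; [exact: nonneg_nat | exact: nonnegq]
  | apply: nonneg_dil; exact: nonneg_c].
Qed.

Lemma nonneg_a : nonneg a.
Proof.
elim/ltn_ind => n IH; case: (posnP n) => [->|n0]; first by rewrite a0.
rewrite cub_a_dissect3 coefD addr_ge0 ?nonneg_qc3//.
by rewrite coef_dil; case: ifP => // _; apply: IH; rewrite ltn_Pdiv.
Qed.

(** * Positivity of a and c at represented numbers *)

Definition qform (x y : int) : int := x * x + x * y + y * y.

(** If x or y is odd, symmetry makes y odd, and 4(3m+1) = (2x+y)^2 + 3y^2 with 2x+y = 6k+1 and y =
    4l+1 up to sign. Then m is twice a generalised pentagonal plus a triangular number, an exponent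
    of psi(q^2) P(q^2). If both are even, m = 4k+1 and q c(q^4) allows descent. *)
Lemma c_gt0 m x y : qform x y = (3 * m + 1)%:Z -> 0 < coef c m.
Proof.
rewrite /qform; elim/ltn_ind: m x y => m IH.
have main (x y : int) : x * x + x * y + y * y = (3 * m + 1)%:Z -> (y %% 2)%Z = 1 ->
    0 < coef c m.
  move=> E y1; rewrite cub_c_dissect2 coefD ltr_pwDl//; last first.
    apply: nonnegM; first exact: nonnegq.
    by apply: nonneg_dil; exact: nonneg_c.
  have [l [s [lE s1]]] : exists l s : int, s * y = 4 * l + 1 /\ s * s = 1.
    case: (eqVneq (y %% 4)%Z 1) => h.
      by exists (divz y 4), 1; split; lia.
    by exists (divz (- y) 4), (-1); split; lia.
  (* Otherwise 3 would divide the value 3m + 1 of the form. *)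
  have z3 : ((2 * x + y) %% 3)%Z != 0.
    apply/eqP => h3; have [u uE] : exists u, y = 3 * u - 2 * x.
      by exists (divz (2 * x + y) 3); lia.
    rewrite uE in E.
    have : 3 * (x * x - 3 * u * x + 3 * u * u) = (3 * m + 1)%:Z by rewrite -E; ring.
    by lia.
  have [k [r [kE r1]]] : exists k r : int, r * (2 * x + y) = 6 * k + 1 /\ r * r = 1.
    case: (eqVneq ((2 * x + y) %% 6)%Z 1) => h.
      by exists (divz (2 * x + y) 6), 1; split; lia.
    by exists (divz (- (2 * x + y)) 6), (-1); split; lia.
  have mE : m = (2 * (tpsi l + tpent k))%N.
    have := tpsiE l; have := tpentE k.
    have zz : (6 * k + 1) * (6 * k + 1) = (2 * x + y) * (2 * x + y).
      by rewrite -kE mulrACA r1 mul1r.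
    have yy : (4 * l + 1) * (4 * l + 1) = y * y by rewrite -lE mulrACA s1 mul1r.
    by lia.
  rewrite mE coef_dil dvdn_mulr// mulKn//; apply: coefM_gt0.
  - exact: nonneg_theta1.
  - exact: nonneg_theta1.
  - exact: theta1_gt0 tpsi_ge.
  - exact: theta1_gt0 tpent_ge.
move=> x y E; case: (eqVneq (y %% 2)%Z 1) => y2; first exact: (main x y).
case: (eqVneq (x %% 2)%Z 1) => x2; first by apply: (main y x) => //; rewrite -E; ring.
have [u uE] : exists u, x = 2 * u by exists (divz x 2); lia.
have [v vE] : exists v, y = 2 * v by exists (divz y 2); lia.
have E' : 4 * (u * u + u * v + v * v) = (3 * m + 1)%:Z by rewrite -E uE vE; ring.
have [k kE] : exists k, m = (4 * k + 1)%N by exists (m %/ 4)%N; lia.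
rewrite cub_c_dissect2 coefD ltr_wpDl//.
  by apply/nonneg_dil/nonnegM; apply: nonneg_theta1.
rewrite coefqM {1}kE addn1 coef_dil dvdn_mulr// mulKn//.
by apply: (IH k _ u v); lia.
Qed.

(** If x = y modulo 3, the value is three times a smaller one and a(q^3) contributes; otherwise it
    is 1 modulo 3 and 6 q c(q^3) contributes. *)
Lemma a_gt0 n x y : qform x y = n%:Z -> 0 < coef a n.
Proof.
rewrite /qform; elim/ltn_ind: n x y => n IH x y E.
case: (posnP n) => [->|n0]; first by rewrite a0.
rewrite cub_a_dissect3 coefD.
case: (eqVneq ((x - y) %% 3)%Z 0) => h.
  have [t tE] : exists t, x = y + 3 * t by exists (divz (x - y) 3); lia.
  have E' : 3 * ((y + t) * (y + t) + (y + t) * t + t * t) = n%:Z.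
    by rewrite -E tE; ring.
  have [k kE] : exists k, n = (3 * k)%N by exists (n %/ 3)%N; lia.
  rewrite ltr_pwDl ?nonneg_qc3// kE coef_dil dvdn_mulr// mulKn//.
  by apply: (IH k _ (y + t) t); lia.
have [k kE] : exists k, n = (3 * k + 1)%N.
  have [t [s [tE s1]]] : exists t s : int, x = y + 3 * t + s /\ s * s = 1.
    case: (eqVneq ((x - y) %% 3)%Z 1) => h1.
      by exists (divz (x - y) 3), 1; lia.
    by exists (divz (x - y + 1) 3), (-1); lia.
  have : 3 * (y * y + 3 * t * y + s * y + 3 * t * t + 2 * s * t) + s * s = n%:Z.
    by rewrite -E tE; ring.
  by move=> hn; exists (n %/ 3)%N; lia.
rewrite ltr_wpDl//; first by apply: nonneg_dil; exact: nonneg_a.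
rewrite -mulrA coef_natM mulr_gt0// kE addn1 coefqM coef_dil dvdn_mulr// mulKn//.
by apply: (@c_gt0 k x y); rewrite /qform E kE.
Qed.

Lemma aa2_gt0 n : 0 < coef (a * a2) n.
Proof.
have [d [s [t [u E]]]] := sum_1236 n.
(* The substitution (d - s, 2s) exhibits d^2 + 3s^2 as a value of x^2 + xy + y^2. *)
have f1 : qform (d - s) (2 * s) = d * d + 3 * (s * s) by rewrite /qform; ring.
have f2 : qform (t - u) (2 * u) = t * t + 3 * (u * u) by rewrite /qform; ring.
have [i iE] : exists i : nat, d * d + 3 * (s * s) = i%:Z.
  by exists (absz (d * d + 3 * (s * s))); nia.
have [j jE] : exists j : nat, t * t + 3 * (u * u) = j%:Z.
  by exists (absz (t * t + 3 * (u * u))); nia.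
have -> : n = (i + 2 * j)%N by lia.
apply: coefM_gt0.
- exact: nonneg_a.
- by apply: nonneg_dil; exact: nonneg_a.
- exact: a_gt0 (etrans f1 iE).
- by rewrite coef_dil dvdn_mulr// mulKn//; exact: a_gt0 (etrans f2 jE).
Qed.

Lemma norm_b n : `|coef b n| <= coef a n.
Proof.
rewrite cub_a_dissect3 cub_b_dissect3 coefB coefD -!mulrA !coef_natM.
have h1 : 0 <= coef (dil 3 a) n by apply: nonneg_dil; exact: nonneg_a.
have h2 : 0 <= coef (q * dil 3 c) n.
  by apply: nonnegM; [exact: nonnegq | apply: nonneg_dil; exact: nonneg_c].
by rewrite ler_norml; apply/andP; split; lia.
Qed.

Lemma norm_bb2 n : `|coef (b * b2) n| <= coef (a * a2) n.
Proof.
rewrite !coefM; apply: (le_trans (ler_norm_sum _ _ _)); apply: ler_sum => i _.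
by rewrite normrM ler_pM// ?norm_b// !coef_dil; case: ifP => _; rewrite ?norm_b.
Qed.

(** * The 3-dissection of the eta quotient *)

Lemma eta_quotient : (b * psi) ^+ 2 * e3 ^+ 2 = e1 ^+ 4 * e2 ^+ 4.
Proof.
have -> : (b * psi) ^+ 2 * e3 ^+ 2 = (b * e3 * psi) ^+ 2 by ring.
rewrite cub_bE (_ : (e1 ^+ 3 * psi) ^+ 2 = e1 ^+ 4 * (psi * e1) ^+ 2); last by ring.
by rewrite psi_prod; ring.
Qed.

(** In the section of residue 0 one factor a P of a^2 P^2 is expanded by [cub_a_pent], so that all
    three sections display a a(q^2), the product whose coefficients have been shown positive. *)
Lemma eta_sections :
  [/\ sec 3 0 ((b * psi) ^+ 2) =
        a * a2 * pent ^+ 2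
        + (6%:R * q * psi3 * c2 * (a * pent) + 12%:R * q * c * psi3 ^+ 2 * a2),
      sec 3 1 ((b * psi) ^+ 2) = - (pent * psi3 * (3%:R * (a * a2) + b * b2))
    & sec 3 2 ((b * psi) ^+ 2) =
        - (2%:R * psi3 ^+ 2 * (a * a2 + 18%:R * q * c * c2))].
Proof.
(* Multiplying the two dissections gives the middle section a Psi - 3 c P, which is -2 Psi
   a(q^2). *)
have bp : b * psi = dil 3 (a * pent) + q * dil 3 (- (2%:R * psi3 * a2))
    + q ^+ 2 * dil 3 (- (3%:R * c * psi3)).
  rewrite -cub_a2_pent cub_b_dissect3 [psi in LHS]psi_split.
  rewrite !(rmorph_nat, rmorphN, rmorphM, rmorphB) /=; ring.
have [s0 s1 s2] := sec3_dissect (a * pent) (- (2%:R * psi3 * a2)) (- (3%:R * c * psi3)).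
rewrite expr2; have [-> -> ->] := sec3M (b * psi) (b * psi).
rewrite bp s0 s1 s2; split.
- have -> : a * pent * (a * pent) = (a * pent) * (a2 * pent + 6%:R * q * psi3 * c2).
    by rewrite -cub_a_pent.
  by ring.
- rewrite cub_b_c.
  have -> : - (3%:R * c * psi3) * - (3%:R * c * psi3) = 9%:R * c * psi3 * (psi3 * c).
    by ring.
  by rewrite -pent_cub_c2; ring.
- have -> : a * pent * - (3%:R * c * psi3) + - (2%:R * psi3 * a2) * - (2%:R * psi3 * a2)
     + - (3%:R * c * psi3) * (a * pent) =
     4%:R * psi3 ^+ 2 * a2 ^+ 2 - 2%:R * a * psi3 * (3%:R * c * pent) by ring.
  have -> : 3%:R * c * pent = a * psi3 + 2%:R * psi3 * a2.
    by rewrite -cub_a2_pent addrC subrK.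
  by rewrite -cub_a_c; ring.
Qed.

(** Up to its sign, each section contains a strictly positive series times a nonnegative one with
    constant term 1, so no coefficient vanishes. *)
Lemma sgz_eta n :
  sgz (coef ((b * psi) ^+ 2) n) = if (3 %| n)%N then 1 else -1.
Proof.
have nna := nonneg_a; have nnc := nonneg_c.
have nna2 : nonneg a2 by exact: nonneg_dil.
have nnc2 : nonneg c2 by exact: nonneg_dil.
have nnp : nonneg pent by exact: nonneg_theta1.
have nns : nonneg psi3 by apply: nonneg_dil; exact: nonneg_theta1.
have nnn := nonneg_nat; have nnq := nonnegq.
have nnaa : nonneg (a * a2) by exact: nonnegM.
have [s0 s1 s2] := eta_sections.
have [m [j [nE j3]]] : exists m j, n = (3 * m + j)%N /\ (j < 3)%N.
  by exists (n %/ 3)%N, (n %% 3)%N; rewrite ltn_mod {1}(divn_eq n 3) mulnC.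
have nd i : (0 < i < 3)%N -> (3 %| 3 * m + i)%N = false.
  by move=> i3; apply/negbTE/negP => /dvdnP [l]; lia.
rewrite nE -coef_sec; case: j j3 {nE} => [|[|[|]]]// _.
- rewrite addn0 dvdn_mulr// s0 gtr0_sgz// coefD ltr_pwDl//.
    apply: coefM_gt0r => //; [exact: nonnegX | exact: aa2_gt0 |].
    by rewrite expr2 coefM0 pent0.
  apply: nonnegD; last by do 4 apply: nonnegM => //; apply: nonnegX.
  by apply: nonnegM; [do 3 apply: nonnegM => // | apply: nonnegM].
- rewrite nd// s1 coefN sgzN gtr0_sgz// mulrC.
  (* As b b(q^2) is bounded by a a(q^2), the sum is at least 2 a a(q^2) coefficientwise. *)
  have pos k : 0 < coef (3%:R * (a * a2) + b * b2) k.
    rewrite coefD coef_natM; have := norm_bb2 k; have := aa2_gt0 k.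
    by rewrite ler_norml => h /andP[h' _]; lia.
  apply: coefM_gt0r => //; [by move=> k; exact: ltW | exact: nonnegM |].
  by rewrite coefM0 pent0 psi3_0.
- rewrite nd// s2 coefN sgzN gtr0_sgz// -mulrA coef_natM mulr_gt0// mulrC.
  have pos k : 0 < coef (a * a2 + 18%:R * q * c * c2) k.
    rewrite coefD ltr_pwDl ?aa2_gt0//.
    by apply: nonnegM => //; apply: nonnegM => //; apply: nonnegM.
  apply: coefM_gt0r => //; [by move=> k; exact: ltW | exact: nonnegX |].
  by rewrite expr2 coefM0 psi3_0.
Qed.

(** * The truncated products *)

Lemma Fps_smul f g : Fps (smul f g) = Fps f * Fps g. Proof. by []. Qed.

Lemma Fps_sone : Fps sone = 1.
Proof. by apply: fpsP => -[|n]. Qed.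

Lemma Fps_sexp f k : Fps (sexp f k) = Fps f ^+ k.
Proof.
by elim: k => [|k IH]; rewrite ?Fps_sone// exprS -IH.
Qed.

Lemma Fps_poch m N : Fps (poch_trunc m N) = \prod_(j < N) (1 - q ^+ (m * j.+1)).
Proof.
rewrite /poch_trunc (big_morph Fps Fps_smul Fps_sone); apply: eq_bigr => j _.
by apply: fpsP => n; rewrite coefB coef1 coefqn.
Qed.

Lemma Fps_inv_poch m N : (0 < m)%N ->
  Fps (inv_poch_trunc m N) * Fps (poch_trunc m N) = 1.
Proof.
move=> m0; rewrite Fps_poch /inv_poch_trunc (big_morph Fps Fps_smul Fps_sone).
rewrite -big_split big1// => j _ /=; have : (0 < m * j.+1)%N by rewrite muln_gt0 m0.
move: (m * j.+1)%N => d d0; apply: fpsP => n.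
rewrite mulrBr mulr1 mulrC coefB coefqnM coef1 /= /inv_one_minus_q.
case: ltnP => h.
  by rewrite subr0; case: n h => [|n] h; rewrite ?dvdn0// gtnNdvd.
have -> : (d %| n - d)%N = (d %| n)%N by rewrite -{2}(subnK h) dvdn_addl.
by rewrite subrr; case: n h => //; lia.
Qed.

(** The omitted factors do not affect coefficients below q^N; the truncated inverse product is
    compared with 1/f_3 by multiplying with the truncation of f_3. *)
Lemma F_truncE N : eqmod N (Fps (F_trunc N)) ((b * psi) ^+ 2).
Proof.
rewrite /F_trunc (Fps_smul (smul _ _)) (Fps_smul (sexp _ _)) !Fps_sexp.
have T m : (0 < m)%N -> eqmod N (Fps (poch_trunc m N)) (euler m).
  by move=> m0; rewrite Fps_poch; apply/eqmod_sym/eulerE.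
have I3 : eqmod N (Fps (inv_poch_trunc 3 N)) e3^-1.
  have u3 := @euler_unit 3 isT.
  have h := eqmodM (@eqmod_refl N (Fps (inv_poch_trunc 3 N))) (T 3 isT).
  rewrite Fps_inv_poch// in h.
  have := eqmodM (eqmod_sym h) (@eqmod_refl N e3^-1).
  by rewrite mulrK// mul1r.
have -> : (b * psi) ^+ 2 = e1 ^+ 4 * e2 ^+ 4 * e3^-1 ^+ 2.
  by rewrite -eta_quotient exprVn mulrK// unitrX// euler_unit.
by apply: eqmodM; [apply: eqmodM|]; apply: eqmodX => //; apply: T.
Qed.

Theorem theorem1p3 (n N : nat) :
  (1 <= n)%N -> (n < N)%N ->
  sgz (F_trunc N n) = (if (3 %| n)%N then 1 else -1).
Proof. by move=> _ nN; rewrite -sgz_eta -(F_truncE nN). Qed.
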